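(* (i) For any positive integer $n>1$, there are $x,y,z,w\in\mathbb{N}$ and a prime $p$ such that $n=x^2+y^2+z^2+2w^2$ and $x+y=p$. (ii) Any positive integer $n>2$ can be written as $n=x^2+y^2+z^2+2w^2$ with $x,y,z,w\in\mathbb{N}$ such that $x+w$ is prime.
   Context: $\mathbb{N}=\{0,1,2,\dots\}$. *)

(* Defs.v *)
From mathcomp Require Export all_boot.

(* Main.v *)
(* If x + y = p then 2n - p^2 = (x - y)^2 + 2z^2 + 4w^2, and if x + w = p then
   3n - 2p^2 = (x - 2w)^2 + 3y^2 + 3z^2.  Both parts therefore need a prime p
   with n <= p^2 <= 3n/2, so that the variables recovered from the ternary form
   are nonnegative, and the fact that u^2 + 2v^2 + 4w^2 represents the odd
   positive integers and u^2 + 3v^2 + 3w^2 the positive integers = 1 mod 3.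

   The prime comes from Chebyshev's ratio (30n)! n! / ((15n)! (10n)! (6n)!),
   whose bounds (a factor 6/5 apart) give a prime in (y, 11y/9]; note that
   (11/9)^2 < 3/2.

   The ternary forms are handled through 2m = a^2 + b^2 + c^2 (m odd) and
   3m = a^2 + b^2 + 3c^2.  One constructs a positive form of determinant 1
   (resp. 3) with the required value as a diagonal coefficient, and reduces it.
   The construction asks for q = s^2 q' in a prescribed class l modulo k such
   that -D is a square modulo q'.  Instead of Dirichlet's theorem we use
   r(q) = sum of chi(d) over d | q, for chi the Kronecker symbol of -D: it is
   nonnegative, at least 1 at squares, and nonzero only if chi(p) = 1 for all
   p dividing q to an odd power.  If r vanished on the class l, where
   chi(l) = 1, then the power series of (1_{q = 1} - 1_{q = l}) r(q) t^q would
   grow at least like (1 - t)^(-1/2), because of the squares; but it is the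
   double sum of c(d, e) t^(de) with c periodic and of mean zero in each
   variable, which stays bounded as t -> 1. *)

Require Import Defs.
From Stdlib Require Import NArith.
From mathcomp Require Import all_boot all_order all_algebra all_solvable all_field.
From mathcomp Require Import zify ring lra.
Set Implicit Arguments. Unset Strict Implicit. Unset Printing Implicit Defensive.

(** * Primes in short intervals *)

Definition cheb_num n := (30 * n)`! * n`!.
Definition cheb_den n := (15 * n)`! * (10 * n)`! * (6 * n)`!.
Definition cheb_base := 2 ^ 14 * 3 ^ 9 * 5 ^ 5.

Lemma fact_addn n k : (n + k)`! = n`! * \prod_(j <- iota 1 k) (n + j).
Proof.
elim: k => [|k IHk]; first by rewrite addn0 big_nil muln1.
by rewrite -addn1 iotaD big_cat /= big_seq1 mulnA -IHk addnA addn1 factS add1n addnS mulnC.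
Qed.

(* What is left of the ratio of consecutive values after cancelling common
   factors; the residues in cheb_up are the units modulo 30. *)
Definition cheb_up n := (30 * n + 1) * (30 * n + 7) * (30 * n + 11) * (30 * n + 13) *
  (30 * n + 17) * (30 * n + 19) * (30 * n + 23) * (30 * n + 29).
Definition cheb_down n := (30 * n + 6) * (30 * n + 10) * (30 * n + 12) * (30 * n + 15) *
  (30 * n + 18) * (30 * n + 20) * (30 * n + 24) * (30 * n + 30).

Lemma cheb_rec n : cheb_num n.+1 * cheb_den n * cheb_down n =
  cheb_base * cheb_num n * cheb_den n.+1 * cheb_up n.
Proof.
rewrite /cheb_num /cheb_den (mulnS 30) (mulnS 15) (mulnS 10) (mulnS 6).
rewrite (addnC 30) (addnC 15) (addnC 10) (addnC 6).
rewrite (fact_addn _ 30) (fact_addn _ 15) (fact_addn _ 10) (fact_addn _ 6) factS.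
move: (30 * n)`! (15 * n)`! (10 * n)`! (6 * n)`! n`! => A B C D E.
rewrite [iota 1 30]/= [iota 1 15]/= [iota 1 10]/= [iota 1 6]/= !big_cons !big_nil.
rewrite /cheb_up /cheb_down /cheb_base -[n.+1]addn1.
ring.
Qed.

Lemma cheb_num_gt0 n : 0 < cheb_num n.
Proof. by rewrite muln_gt0 !fact_gt0. Qed.

Lemma cheb_den_gt0 n : 0 < cheb_den n.
Proof. by rewrite !muln_gt0 !fact_gt0. Qed.

Lemma cheb_up_gt0 n : 0 < cheb_up n.
Proof. by rewrite !muln_gt0 !addn_gt0 !orbT. Qed.

Lemma cheb_up_le n : cheb_up n <= cheb_down n.
Proof. by rewrite /cheb_up /cheb_down !leq_mul // leq_add2l. Qed.

(** Once [30 * n + 1] and [30 * n + 30] are set aside, the remaining factors of [cheb_down] in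
    increasing order lie below those of [cheb_up], so the ratio of consecutive values falls short of
    [cheb_base] by little. *)
Lemma cheb_down_le n : (30 * n + 1) * cheb_down n <= (30 * n + 30) * cheb_up n.
Proof.
rewrite /cheb_up /cheb_down; set x := 30 * n.
have h : (x + 6) * (x + 10) * (x + 12) * (x + 15) * (x + 18) * (x + 20) * (x + 24) <=
         (x + 7) * (x + 11) * (x + 13) * (x + 17) * (x + 19) * (x + 23) * (x + 29).
  by rewrite !leq_mul // leq_add2l.
have := leq_mul (leqnn ((x + 1) * (x + 30))) h.
by congr (_ <= _); ring.
Qed.

Lemma cheb_num_le n : cheb_num n <= cheb_base ^ n * cheb_den n.
Proof.
have rec := cheb_rec; move: cheb_base rec => K rec.
elim: n => [|n IHn] //.
have h : 0 < cheb_den n * cheb_down n.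
  by rewrite muln_gt0 cheb_den_gt0 (leq_trans (cheb_up_gt0 n) (cheb_up_le n)).
rewrite -(leq_pmul2r h) mulnA rec expnS -!(mulnA K) leq_mul2l; apply/orP; right.
apply: leq_trans (leq_mul (leq_mul IHn (leqnn _)) (cheb_up_le n)) _.
by rewrite eq_leq //; ring.
Qed.

(** Each step loses at most the factor (30n + 1) / (30n + 30), which exceeds (30n + 1) / (30(n + 1)
    + 1); these losses telescope. *)
Lemma cheb_num_ge n : cheb_base ^ n * cheb_den n <= (30 * n + 1) * cheb_num n.
Proof.
have rec := cheb_rec; move: cheb_base rec => K rec.
elim: n => [|n IHn] //.
have h : 0 < cheb_num n * cheb_up n by rewrite muln_gt0 cheb_num_gt0 cheb_up_gt0.
rewrite -(leq_pmul2r h).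
have -> : K ^ n.+1 * cheb_den n.+1 * (cheb_num n * cheb_up n) =
          K ^ n * cheb_den n * (cheb_num n.+1 * cheb_down n).
  transitivity (K ^ n * (K * cheb_num n * cheb_den n.+1 * cheb_up n)).
    by rewrite expnS; ring.
  by rewrite -rec; ring.
apply: leq_trans (leq_mul IHn (leqnn _)) _.
have := leq_mul (leqnn (cheb_num n * cheb_num n.+1)) (cheb_down_le n).
set u := (X in X <= _) => uv.
have -> : (30 * n + 1) * cheb_num n * (cheb_num n.+1 * cheb_down n) = u by rewrite /u; ring.
apply: leq_trans uv _.
have le_c : 30 * n + 30 <= 30 * n.+1 + 1 by lia.
have := leq_mul le_c (leqnn (cheb_num n * cheb_num n.+1 * cheb_up n)).
by congr (_ <= _); ring.
Qed.

Lemma logn_fact_le p n M : prime p -> n <= M -> logn p n`! = \sum_(1 <= k < M.+1) n %/ p ^ k.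
Proof.
move=> p_pr le_nM; rewrite logn_fact // [RHS](big_cat_nat _ (n := n.+1)) //=.
rewrite [X in _ = _ + X]big_nat_cond [X in _ = _ + X]big1 ?addn0 // => k /andP[/andP[lt_nk _] _].
by rewrite divn_small // (leq_trans lt_nk) // ltnW // ltn_expl // prime_gt1.
Qed.

(** For a = floor(30n / p^k) this is the contribution of p^k to the exponent of p in Chebyshev's
    ratio, by Legendre's formula. The truncated subtraction loses nothing, see [cheb_floorE]. *)
Definition cheb_floor a := a + a %/ 30 - (a %/ 2 + a %/ 3 + a %/ 5).

Lemma cheb_floorE a : a %/ 2 + a %/ 3 + a %/ 5 + cheb_floor a = a + a %/ 30.
Proof. by rewrite /cheb_floor; lia. Qed.

Lemma cheb_floor_le1 a : cheb_floor a <= 1.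
Proof. by rewrite /cheb_floor; lia. Qed.

Lemma cheb_floor_lt6 a : 0 < a < 6 -> cheb_floor a = 1.
Proof. by rewrite /cheb_floor; lia. Qed.

Lemma logn_cheb_num p n : prime p ->
  logn p (cheb_num n) = logn p (cheb_den n) + \sum_(1 <= k < (30 * n).+1) cheb_floor (30 * n %/ p ^ k).
Proof.
move=> p_pr; rewrite /cheb_num /cheb_den !lognM ?muln_gt0 ?fact_gt0 //.
rewrite !(@logn_fact_le p _ (30 * n)) ?leq_mul2r ?orbT ?leq_pmull // -!big_split /=.
apply: eq_bigr => k _; have p_gt0 := expn_gt0 p k.
have divE m c : 0 < c -> m * c * n %/ p ^ k %/ c = m * n %/ p ^ k.
  by move=> c_gt0; rewrite -divnMA mulnAC divnMr.
by rewrite -(divE 15 2) // -(divE 10 3) // -(divE 6 5) // -{2}[n]mul1n -(divE 1 30) // cheb_floorE.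
Qed.

Lemma dvdn_logn a b : 0 < a -> 0 < b -> (forall p, prime p -> logn p a <= logn p b) -> a %| b.
Proof.
move=> a_gt0 b_gt0 h; apply/dvdn_partP => // p; rewrite mem_primes => /and3P[p_pr _ _].
by rewrite p_part pfactor_dvdn // h.
Qed.

Lemma cheb_den_dvd n : cheb_den n %| cheb_num n.
Proof.
apply: dvdn_logn; rewrite ?cheb_num_gt0 ?cheb_den_gt0 // => p p_pr.
by rewrite logn_cheb_num // leq_addr.
Qed.

Definition cheb n := cheb_num n %/ cheb_den n.

Lemma cheb_numE n : cheb_num n = cheb n * cheb_den n.
Proof. by rewrite divnK // cheb_den_dvd. Qed.

Lemma cheb_gt0 n : 0 < cheb n.
Proof. by have := cheb_num_gt0 n; rewrite cheb_numE muln_gt0 => /andP[]. Qed.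

Lemma cheb_le n : cheb n <= cheb_base ^ n.
Proof. by rewrite -(leq_pmul2r (cheb_den_gt0 n)) -cheb_numE cheb_num_le. Qed.

Lemma cheb_ge n : cheb_base ^ n <= (30 * n + 1) * cheb n.
Proof. by rewrite -(leq_pmul2r (cheb_den_gt0 n)) -mulnA -cheb_numE cheb_num_ge. Qed.

Lemma logn_cheb p n : prime p ->
  logn p (cheb n) = \sum_(1 <= k < (30 * n).+1) cheb_floor (30 * n %/ p ^ k).
Proof.
move=> p_pr; have := logn_cheb_num n p_pr.
by rewrite cheb_numE lognM ?cheb_gt0 ?cheb_den_gt0 // addnC => /addnI.
Qed.

Lemma logn_cheb_le p n : prime p -> 0 < n -> logn p (cheb n) <= trunc_log p (30 * n).
Proof.
move=> p_pr n_gt0; have p_gt1 := prime_gt1 p_pr.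
have lt_t : trunc_log p (30 * n) < (30 * n).+1.
  by rewrite ltnS (leq_trans (ltnW (ltn_expl _ p_gt1))) // trunc_logP // muln_gt0.
rewrite logn_cheb // (big_cat_nat _ (n := (trunc_log p (30 * n)).+1)) //=.
rewrite [X in _ + X]big_nat_cond [X in _ + X]big1 ?addn0 => [|k /andP[/andP[lt_tk _] _]].
  apply: leq_trans (leq_sum _ (E2 := fun=> 1) _) _ => [k _|]; first exact: cheb_floor_le1.
  by rewrite sum_nat_const_nat muln1 subSS subn0.
rewrite divn_small // (leq_trans (trunc_log_ltn _ p_gt1)) // leq_exp2l //.
Qed.

Definition primorial n := \prod_(0 <= p < n.+1 | prime p) p.

Lemma primorial_gt0 n : 0 < primorial n.
Proof. by rewrite prodn_cond_gt0 // => p /prime_gt0. Qed.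

Lemma prod_primes_dvd m n N :
  (forall p, prime p -> m <= p < n -> p %| N) -> \prod_(m <= p < n | prime p) p %| N.
Proof.
elim: n => [|n IHn] h; first by rewrite big_geq // dvd1n.
have [le_mn|lt_nm] := leqP m n; last by rewrite big_geq // dvd1n.
rewrite big_mkcond big_nat_recr //= -big_mkcond /=.
have IH : \prod_(m <= i < n | prime i) i %| N.
  by apply: IHn => p p_pr /andP[le_mp lt_pn]; rewrite h // le_mp ltnW.
case: ifP => [n_pr|_]; rewrite ?muln1 // Gauss_dvd; first by rewrite IH h ?le_mn /=.
rewrite big_nat_cond coprime_sym; apply: (big_ind (coprime n)) => [|x y|p].
- exact: coprimen1.
- by rewrite coprimeMr => -> ->.
by case/andP=> /andP[_ lt_pn] p_pr; rewrite prime_coprime // dvdn_prime2 // gtn_eqF.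
Qed.

Lemma primorial_cat m n : m <= n ->
  primorial n = primorial m * \prod_(m.+1 <= p < n.+1 | prime p) p.
Proof. by move=> le_mn; rewrite /primorial (big_cat_nat _ (n := m.+1)). Qed.

(** A prime p in (5n, 30n] has 1 <= floor(30n / p) <= 5, where [cheb_floor] equals 1, so p divides
    [cheb n]. *)
Lemma primorial_cheb n : primorial (30 * n) <= primorial (5 * n) * cheb n.
Proof.
rewrite (@primorial_cat (5 * n)) ?leq_mul2r ?orbT // leq_pmul2l ?primorial_gt0 //.
apply: dvdn_leq; first exact: cheb_gt0.
apply: prod_primes_dvd => p p_pr /andP[lt_np]; rewrite ltnS => le_pn.
rewrite -[p]expn1 pfactor_dvdn ?cheb_gt0 // logn_cheb // big_ltn; last lia.
rewrite expn1 cheb_floor_lt6 // divn_gt0 ?prime_gt0 // le_pn ltn_divLR ?prime_gt0 //; lia.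
Qed.

(** The prime powers in [cheb n] are at most 30n, and a prime above s occurs at most once because
    its square exceeds 30n. Only the primes up to s need the extra factor 30n. *)
Lemma cheb_le_primorial n s : 0 < n -> 30 * n < s.+1 ^ 2 ->
  cheb n <= (30 * n) ^ s * primorial (30 * n).
Proof.
move=> n_gt0 lt_ns; set X := 30 * n in lt_ns *.
have X_gt0 : 0 < X by rewrite muln_gt0.
pose F p := (if p <= s then X else 1) * p.
have le_sX : cheb n <= \prod_(0 <= p < X.+1 | prime p) p ^ logn p (cheb n).
  have P_gt0 : 0 < \prod_(0 <= p < X.+1 | prime p) p ^ logn p (cheb n).
    by rewrite prodn_cond_gt0 // => p p_pr; rewrite expn_gt0 prime_gt0.
  apply: dvdn_leq => //; apply: dvdn_logn => // [|p p_pr]; first exact: cheb_gt0.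
  rewrite -pfactor_dvdn //; have [->|lp_gt0] := posnP (logn p (cheb n)); first exact: dvd1n.
  rewrite big_mkcond (bigD1_seq p) ?mem_index_iota ?iota_uniq //=; last first.
    rewrite ltnS; have := leq_trans lp_gt0 (logn_cheb_le p_pr n_gt0).
    by rewrite trunc_log_gt0; lia.
  by rewrite p_pr dvdn_mulr.
apply: leq_trans le_sX _.
have leF : \prod_(0 <= p < X.+1 | prime p) p ^ logn p (cheb n) <=
           \prod_(0 <= p < X.+1 | prime p) F p.
  apply: leq_prod => p p_pr.
  rewrite /F; have p_gt1 := prime_gt1 p_pr; have le_l := logn_cheb_le p_pr n_gt0.
  case: ifP => [_|/negbT]; last rewrite -ltnNge => lt_sp.
    rewrite (@leq_trans X) ?leq_pmulr ?prime_gt0 // (leq_trans _ (trunc_logP p_gt1 X_gt0)) //.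
    by rewrite leq_exp2l.
  rewrite mul1n -[X in _ <= X]expn1 leq_exp2l // (leq_trans le_l) //.
  rewrite leqNgt; apply/negP => gt1.
  have := trunc_logP p_gt1 X_gt0; rewrite leqNgt (leq_trans lt_ns) //.
  by rewrite (leq_trans _ (leq_pexp2l (ltnW p_gt1) gt1)) // leq_exp2r.
apply: leq_trans leF _; rewrite big_split /= leq_mul //; move: {1}X => M.
have leM : \prod_(0 <= p < M.+1 | prime p) (if p <= s then X else 1) <= X ^ minn M s.
  elim: M => [|M IHM]; first by rewrite big_mkcond big_nat1 min0n.
  rewrite big_mkcond big_nat_recr //= -big_mkcond /=.
  have [le_Ms|lt_sM] := leqP M.+1 s.
    rewrite expnS mulnC leq_mul //; first by case: ifP.
    by apply: leq_trans IHM _; rewrite leq_pexp2l // geq_minl.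
  rewrite if_same muln1; apply: leq_trans IHM _.
  by rewrite leq_pexp2l // geq_minr.
by apply: leq_trans leM _; rewrite leq_pexp2l // geq_minr.
Qed.

Lemma leq_primorial m n : m <= n -> primorial m <= primorial n.
Proof.
move=> le_mn; rewrite (primorial_cat le_mn) leq_pmulr // prodn_cond_gt0 // => p; exact: prime_gt0.
Qed.

Lemma cheb_base_gt : 2 ^ 39 < cheb_base.
Proof. by rewrite /cheb_base; lia. Qed.

(* Iterating primorial_cheb along y |-> 5 * ceil(y / 30) gives the exponent
   (1 + 1/6 + 1/36 + ...) y / 30 = y / 25; every rounding costs at most 29. *)
Lemma primorial_le j y : y <= 5 ^ j -> primorial y ^ 25 <= cheb_base ^ (y + 29 * j + 175).
Proof.
have K_gt : 30 <= cheb_base.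
  by apply: leq_trans (ltnW cheb_base_gt); apply: (@leq_trans (2 ^ 5)) => //; rewrite leq_exp2l.
have base n : primorial (30 * n) <= cheb_base ^ n * primorial (5 * n).
  by apply: leq_trans (primorial_cheb n) _; rewrite mulnC leq_mul2r cheb_le orbT.
have P5 : primorial 5 = 30 by rewrite /primorial !big_mkcond unlock.
move: cheb_base K_gt base => K K_gt base.
have K_gt0 : 0 < K by apply: leq_trans K_gt.
(* Origin of 175 = 7 * 25: the case n = 5 gives K^5, the case n = 1 gives K, and the remaining
   [primorial 5] = 30 is at most K. *)
have P150 : primorial 150 <= K ^ 7.
  have := base 5; rewrite -[30 * 5]/150 -[5 * 5]/25 => /leq_trans; apply.
  rewrite (expnD K 5 2) leq_mul2l; apply/orP; right.
  apply: leq_trans (_ : _ <= primorial 30) _; first exact: leq_primorial.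
  have := base 1; rewrite -[30 * 1]/30 -[5 * 1]/5 P5 expn1 => /leq_trans; apply.
  by rewrite expnS expn1 leq_mul2l K_gt orbT.
elim: j y => [|j IHj] y le_y.
  apply: leq_trans (_ : _ <= (K ^ 7) ^ 25) _.
    rewrite leq_exp2r // (leq_trans _ P150) // leq_primorial //; lia.
  by rewrite -expnM leq_pexp2l //; lia.
have [le_y150|lt_y] := leqP y 150.
  apply: leq_trans (_ : _ <= (K ^ 7) ^ 25) _.
    by rewrite leq_exp2r // (leq_trans _ P150) // leq_primorial.
  by rewrite -expnM leq_pexp2l //; lia.
set n := (y + 29) %/ 30.
have le_yn : y <= 30 * n by rewrite /n; lia.
have le_ny : 30 * n <= y + 29 by rewrite /n; lia.
have le_nj : 5 * n <= 5 ^ j by move: le_y; rewrite expnS; lia.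
apply: leq_trans (_ : _ <= (K ^ n * primorial (5 * n)) ^ 25) _.
  by rewrite leq_exp2r // (leq_trans _ (base n)) // leq_primorial.
rewrite expnMn -expnM; apply: leq_trans (leq_mul (leqnn _) (IHj _ le_nj)) _.
by rewrite -expnD leq_pexp2l //; lia.
Qed.

Lemma exists_prime_large y : 1000 * 1000 <= y -> exists2 p, prime p & (y < p) && (9 * p <= 11 * y).
Proof.
(* [X] is the largest multiple of 30 not exceeding 11y / 9. *)
move=> le_y; set n := (11 * y) %/ 270; set X := 30 * n.
have n_gt0 : 0 < n by rewrite /n; lia.
have le_Xy : 9 * X <= 11 * y by rewrite /X /n; lia.
have lt_yX : 11 * y < 9 * X + 270 by rewrite /X /n; lia.
clearbody n.
have le_yX : y <= X by lia.
have [s le_sX lt_Xs] : exists2 s, s ^ 2 <= X & X < s.+1 ^ 2.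
  have [|s|s le_s max_s] := @ex_maxnP (fun s => s ^ 2 <= X) X; first by exists 0.
    by apply: leq_trans; rewrite -mulnn; nia.
  by exists s => //; rewrite ltnNge; apply/negP => /max_s; rewrite ltnn.
have s_ge : 1100 <= s.
  by rewrite leqNgt; apply/negP => lt_s; have : s.+1 ^ 2 <= 1100 * 1100; [rewrite -mulnn leq_mul | lia].
(* A crude logarithm: s + 1 <= 2^e while 100 e <= s, so that error terms of order e s stay below a
   small multiple of s^2, hence of y. *)
set e := s %/ 100.
have lt_se : s.+1 <= 2 ^ e.
  have : 100 * e + 100 <= 2 ^ e; last by rewrite /e; lia.
  have : 11 <= e by rewrite /e; lia.
  elim: e => // e IHe; rewrite leq_eqVlt => /orP[/eqP<- // | /IHe].
  by rewrite expnS; lia.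
have lt_ye : y <= 5 ^ e.
  apply: leq_trans (_ : (2 ^ e) ^ 2 <= _).
    by rewrite (leq_trans le_yX) // (leq_trans (ltnW lt_Xs)) // leq_exp2r.
  by rewrite -expnM mulnC expnM leq_exp2r //; rewrite /e; lia.
(* Without primes in (y, X], comparing K ^ (25 n) with cheb n ^ 25 and with
   primorial y ^ 25 would bound 25 n - y, which is about y / 54, by O(sqrt y log y). *)
case: (boolP [exists p : 'I_X.+1, prime p && (y < p)]) => [/existsP[p /andP[p_pr lt_yp]]|].
  exists p => //; rewrite lt_yp; have := ltn_ord p; lia.
rewrite negb_exists => /forallP no_prime; exfalso.
have PX : primorial X = primorial y.
  rewrite (primorial_cat le_yX) big_nat_cond big_pred0 ?muln1 // => p.
  apply/negP => /andP[/andP[lt_yp lt_pX] p_pr].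
  by have := no_prime (Ordinal lt_pX); rewrite /= p_pr lt_yp.
have := cheb_ge n; have := cheb_le_primorial n_gt0 lt_Xs; rewrite -/X PX.
have := primorial_le lt_ye; have := cheb_base_gt.
move: (primorial y) (cheb n) cheb_base => P Q K K_gt le_P le_Q le_K.
have lt_X2e : X.+1 <= 2 ^ (2 * e).
  by apply: leq_trans lt_Xs _; rewrite mulnC expnM leq_exp2r.
have K_gt0 : 0 < K by apply: leq_ltn_trans K_gt.
have le_Kn : K ^ (25 * n) <= 2 ^ (50 * e * s.+1) * K ^ (y + 29 * e + 175).
  apply: leq_trans (_ : _ <= (2 ^ (2 * e * s.+1) * P) ^ 25) _.
    rewrite mulnC expnM leq_exp2r // (leq_trans le_K) // addn1.
    apply: leq_trans (leq_mul lt_X2e le_Q) _; rewrite mulnA leq_mul //.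
    rewrite mulnS expnD leq_mul // expnM leq_exp2r; first exact: ltnW.
    exact: leq_trans s_ge.
  rewrite expnMn -expnM; apply: leq_mul => //.
  by rewrite eq_leq //; congr (2 ^ _); ring.
have {}e_le : 100 * e <= s by rewrite /e; lia.
clearbody e.
have le_es : 100 * (e * s.+1) <= s * s.+1 by rewrite mulnA leq_mul.
have le_ss : 1100 * s <= s * s by rewrite leq_mul.
rewrite -mulnn in le_sX.
have lt_n : y + 29 * e + 175 <= 25 * n by rewrite /X in le_sX lt_yX le_Xy; lia.
move: le_Kn; rewrite -{1}(subnK lt_n) expnD leq_pmul2r ?expn_gt0 ?K_gt0 //.
rewrite leqNgt => /negP; apply.
(* 39 is hidden so that [//] does not compute 2 ^ 39 in unary. *)
have [b bE] : exists b, b = 39 by exists 39.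
rewrite -bE in K_gt.
apply: (@leq_trans ((2 ^ b) ^ (25 * n - (y + 29 * e + 175)))); last first.
  by rewrite leq_exp2r ?(ltnW K_gt) // subn_gt0; lia.
by rewrite -expnM ltn_exp2l //; rewrite /X in le_sX lt_yX le_Xy; lia.
Qed.

(* The tests are nested conditionals because [&&], [||] and [has] are strict
   under vm_compute. *)
Fixpoint no_divisor_from (fuel : nat) (d p : N) : bool :=
  if N.ltb p (d * d) then true else
  if fuel is f.+1 then if N.eqb (p mod d) 0 then false else no_divisor_from f (d + 1) p
  else false.

(** The fuel lets trial division run through all divisors up to 1101, enough for the largest prime
    tested, 1111021. Running out of fuel yields [false], so soundness does not depend on it. *)
Definition N_prime (p : N) : bool := N.ltb 1 p && no_divisor_from 1100 2 p.

Lemma no_divisor_fromP fuel d p : 0 < N.to_nat d -> no_divisor_from fuel d p ->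
  forall e, N.to_nat d <= e -> e * e <= N.to_nat p -> ~~ (e %| N.to_nat p).
Proof.
elim: fuel d => [|f IHf] d d_gt0 /=; first by case: N.ltb_spec => // lt_p _ e; nia.
case: N.ltb_spec => [lt_p _ e|_]; first by nia.
case: N.eqb_spec => // ndiv rest e le_de le_ep; rewrite leq_eqVlt in le_de.
case/orP: le_de => [/eqP de|lt_de]; last first.
  by apply: (IHf (d + 1)%num) rest _ _ _; lia.
apply/negP => /dvdnP[k pk]; apply: ndiv.
have -> : p = (N.of_nat k * d)%num by nia.
by rewrite N.Div0.mod_mul.
Qed.

Lemma N_primeP p : N_prime p -> prime (N.to_nat p).
Proof.
case/andP=> /N.ltb_lt p_gt1 nd; apply/negPn/negP => /primePns[|[q [q_pr le_qp dv]]]; first lia.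
have := @no_divisor_fromP _ 2%num p isT nd q; rewrite dv => /(_ _ _)/negP; apply=> //.
by rewrite prime_gt1.
Qed.

Local Arguments N.mul : simpl never.

(** A link from [a] to the prime [b] settles every y with a <= y < b, since 9 b <= 11 a <= 11 y. *)
Fixpoint prime_chain (a : N) (l : seq N) : bool :=
  if l is b :: l' then [&& N_prime b, N.leb (9 * b) (11 * a) & prime_chain b l'] else true.

Lemma prime_chainP a l y : prime_chain a l -> N.to_nat a <= y -> y < N.to_nat (last a l) ->
  exists2 p, prime p & (y < p) && (9 * p <= 11 * y).
Proof.
elim: l a => [|b l IHl] a /=; first by lia.
case/and3P=> /N_primeP b_pr /N.leb_le le_ba chain le_ay lt_y.
have [lt_yb|le_by] := ltnP y (N.to_nat b); last exact: IHl chain le_by lt_y.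
by exists (N.to_nat b) => //; rewrite lt_yb /=; lia.
Qed.

Lemma exists_prime_near y : 29 <= y -> exists2 p, prime p & (y < p) && (9 * p <= 11 * y).
Proof.
move=> le_y; have [/exists_prime_large //|lt_y] := leqP (1000 * 1000) y.
pose l := [:: 31; 37; 43; 47; 53; 61; 73; 89; 107; 127; 151; 181; 211; 257; 313; 379; 463; 563;
  683; 829; 1013; 1237; 1511; 1831; 2237; 2731; 3331; 4057; 4957; 6053; 7393; 9029; 11027; 13477;
  16453; 20107; 24571; 30029; 36697; 44851; 54799; 66973; 81853; 100019; 122231; 149393; 182587;
  223151; 272737; 333341; 407401; 497929; 608527; 743747; 909023; 1111021]%num.
have chain : prime_chain 29 l by vm_compute.
apply: (prime_chainP chain); [lia | have -> : last 29%num l = 1111021%num by []; lia].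
Qed.

(* 29 is the first prime p from which the intervals [2 p^2 / 3, p^2] overlap, and
   561 is the left end of its interval. *)
Lemma exists_prime_window n : 561 <= n -> exists p, [/\ prime p, n <= p ^ 2 & 2 * p ^ 2 <= 3 * n].
Proof.
move=> le_n; have [le_n841|lt_n] := leqP n 841; first by exists 29; split => //; lia.
have [|s|s le_s max_s] := @ex_maxnP (fun s => s ^ 2 <= n) n; first by exists 0.
  by apply: leq_trans; rewrite -mulnn; nia.
have s_ge : 29 <= s by apply: max_s; apply: ltnW.
have lt_n' : n < s.+1 ^ 2 by rewrite ltnNge; apply/negP => /max_s; rewrite ltnn.
have [p p_pr /andP[lt_sp le_ps]] := exists_prime_near s_ge.
exists p; split=> //.
  by rewrite (leq_trans (ltnW lt_n')) // leq_exp2r.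
have : (9 * p) ^ 2 <= (11 * s) ^ 2 by rewrite leq_exp2r.
rewrite !expnMn; lia.
Qed.

(** * Finite verification below 561 *)

Fixpoint lazy_has (T : Type) (a : T -> bool) (s : seq T) : bool :=
  if s is x :: s' then if a x then true else lazy_has a s' else false.

Lemma lazy_hasE (T : Type) (a : T -> bool) s : lazy_has a s = has a s.
Proof. by elim: s => //= x s ->; case: (a x). Qed.

(** Only [x], [y], [w] are searched; [z] is recovered as the integer square root of the
    remainder. *)
Definition N_represents (Q : N -> N -> N -> bool) (n : N) : bool :=
  let r := map N.of_nat (iota 0 (N.to_nat (N.sqrt n)).+1) in
  lazy_has (fun x => lazy_has (fun y => lazy_has (fun w =>
    let v := (x * x + y * y + 2 * (w * w))%num in
    if N.leb v n then let z := N.sqrt (n - v) in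
      if N.eqb (v + z * z) n then Q x y w else false else false) r) r) r.

Lemma N_representsP Q n : N_represents Q n -> exists x y z w : N,
  N.to_nat n = N.to_nat x ^ 2 + N.to_nat y ^ 2 + N.to_nat z ^ 2 + 2 * N.to_nat w ^ 2 /\ Q x y w.
Proof.
rewrite /N_represents lazy_hasE => /hasP[x _]; rewrite lazy_hasE => /hasP[y _].
rewrite lazy_hasE => /hasP[w _]; case: ifP => // _; case: N.eqb_spec => // eq Qxyw.
by exists x, y, (N.sqrt (n - (x * x + y * y + 2 * (w * w)))), w; split=> //; rewrite -!mulnn; lia.
Qed.

Lemma small_prime_xy n : 1 < n -> n < 561 -> exists x y z w p : nat,
  [/\ prime p, n = x ^ 2 + y ^ 2 + z ^ 2 + 2 * w ^ 2 & x + y = p].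
Proof.
move=> n_gt1 n_lt.
have : all (fun k => N_represents (fun x y w => N_prime (x + y)) (N.of_nat k)) (iota 2 559) by vm_compute.
move/allP => /(_ n); rewrite mem_iota => /(_ _)/N_representsP[|x [y [z [w [eq /N_primeP pr]]]]]; first lia.
exists (N.to_nat x), (N.to_nat y), (N.to_nat z), (N.to_nat w), (N.to_nat x + N.to_nat y).
by split => //; [rewrite -[X in prime X]N2Nat.inj_add | rewrite -eq Nat2N.id].
Qed.

Lemma small_prime_xw n : 2 < n -> n < 561 -> exists x y z w : nat,
  n = x ^ 2 + y ^ 2 + z ^ 2 + 2 * w ^ 2 /\ prime (x + w).
Proof.
move=> n_gt1 n_lt.
have : all (fun k => N_represents (fun x y w => N_prime (x + w)) (N.of_nat k)) (iota 3 558) by vm_compute.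
move/allP => /(_ n); rewrite mem_iota => /(_ _)/N_representsP[|x [y [z [w [eq /N_primeP pr]]]]]; first lia.
exists (N.to_nat x), (N.to_nat y), (N.to_nat z), (N.to_nat w).
by split; [rewrite -eq Nat2N.id | rewrite -[X in prime X]N2Nat.inj_add].
Qed.

Import Order.TTheory GRing.Theory Num.Theory.
Local Open Scope ring_scope.

(** * Reduction of positive ternary forms *)

Lemma exists_centered_shift (a t : int) : 0 < a -> exists k : int, - a <= 2 * (t + k * a) <= a.
Proof.
move=> a0; exists (- ((2 * t + a) %/ (2 * a))%Z).
have := divz_eq (2 * t + a) (2 * a); have : 0 <= ((2 * t + a) %% (2 * a))%Z < 2 * a.
  by rewrite modz_ge0 ?ltz_pmod //; lia.
move: (_ %/ _)%Z (_ %% _)%Z => q r; nia.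
Qed.

Lemma centered_sqr_le (x a : int) : - a <= 2 * x <= a -> 4 * x ^+ 2 <= a ^+ 2.
Proof.
move=> h; have : 0 <= (a - 2 * x) * (a + 2 * x) by apply: mulr_ge0; lia.
lia.
Qed.

Definition tform (a b c r s t x y z : int) : int :=
  a * x ^+ 2 + b * y ^+ 2 + c * z ^+ 2 + 2 * r * y * z + 2 * s * x * z + 2 * t * x * y.

(* Determinant of the symmetric matrix of [tform a b c r s t]. *)
Definition tdet (a b c r s t : int) : int :=
  a * b * c + 2 * r * s * t - a * r ^+ 2 - b * s ^+ 2 - c * t ^+ 2.

(** The descent is carried out for an abstract [P] that is inherited through swaps and shears of the
    variables, so that determinant 1 and determinant 3, the latter with a condition on the adjoint
    form, share it. *)
Section Reduction.
Variable P : int -> int -> int -> int -> int -> int -> Prop.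
Hypotheses
  (Pswap12 : forall a b c r s t : int, P b a c s r t -> P a b c r s t)
  (Pswap23 : forall a b c r s t : int, P a c b r t s -> P a b c r s t)
  (Pshear21 : forall k a b c r s t : int,
     P a (b + 2 * k * t + k ^+ 2 * a) c (r + k * s) s (t + k * a) -> P a b c r s t)
  (Pshear32 : forall k a b c r s t : int,
     P a b (c + 2 * k * r + k ^+ 2 * b) (r + k * b) (s + k * t) t -> P a b c r s t).
Variable d : int.
Hypotheses (d_gt0 : 0 < d) (d_le3 : d <= 3).
Hypothesis P1 : forall b c r : int, 0 < b -> b * c - r ^+ 2 = d -> P 1 b c r 0 0.

Lemma Pshear31 (k a b c r s t : int) :
   P a b (c + 2 * k * s + k ^+ 2 * a) (r + k * t) (s + k * a) t -> P a b c r s t.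
Proof. by move=> h; apply/Pswap23/(Pshear21 (k := k))/Pswap23. Qed.

(* Hermite reduction: unimodular substitutions decrease [a] as long as
   27 a^3 > 64 d, hence down to a = 1 when d <= 3. *)
Lemma ternary_reduction (a b c r s t : int) :
  0 < a -> 0 < a * b - t ^+ 2 -> tdet a b c r s t = d -> P a b c r s t.
Proof.
have [n] := ubnP `|a|%N; elim: n => // n IHn in a b c r s t *.
rewrite ltnS => a_le_n a_gt0.
have [N] := ubnP `|(a * b - t ^+ 2)%R|%N; elim: N => // N IHN in b c r s t *.
rewrite ltnS => m_le_N m_gt0 det_eq.
have [a1|a_gt1]: a = 1 \/ 2 <= a by lia.
  move: a1 det_eq m_gt0 => -> det_eq m_gt0.
  apply: (Pshear21 (k := - t)); apply: (Pshear31 (k := - s)).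
  rewrite !mulr1 !subrr ?mulr0 ?addr0; apply: P1; first by lia.
  by rewrite -det_eq /tdet; ring.
(* Completing the square: a f = (a x + t y + s z)^2 + A y^2 + 2 B y z + C z^2, where the binary form
   has determinant a d. *)
pose A : int := a * b - t ^+ 2; pose B : int := a * r - s * t; pose C : int := a * c - s ^+ 2.
have detE : A * C - B ^+ 2 = a * d by rewrite -det_eq /tdet /A /B /C; ring.
have [k hk] := exists_centered_shift B m_gt0.
(* Two nested descents. If 3 A^2 > 4 a d, centering B and swapping the last two variables lowers A
   and keeps a. Otherwise A <= a, and centering t gives a new b with a b <= A + a^2 / 4 < a^2, which
   replaces a. *)
have [hA|hA] := lerP (3 * A ^+ 2) (4 * (a * d)); last first.
  apply: (Pshear32 (k := k)); apply: Pswap23; apply: IHN.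
  - have : (B + k * A) ^+ 2 + a * d = A * (C + 2 * k * B + k ^+ 2 * A) by rewrite -detE; ring.
    have -> : a * (c + 2 * k * r + k ^+ 2 * b) - (s + k * t) ^+ 2 = C + 2 * k * B + k ^+ 2 * A.
      by rewrite /A /B /C; ring.
    rewrite -/A in hk m_gt0 m_le_N.
    move: (B + k * A) (C + 2 * k * B + k ^+ 2 * A) hk => x y /centered_sqr_le hx hy.
    have : A * y < A * A by lia.
    rewrite ltr_pM2l //; lia.
  - have : (B + k * A) ^+ 2 + a * d = A * (C + 2 * k * B + k ^+ 2 * A) by rewrite -detE; ring.
    have -> : a * (c + 2 * k * r + k ^+ 2 * b) - (s + k * t) ^+ 2 = C + 2 * k * B + k ^+ 2 * A.
      by rewrite /A /B /C; ring.
    rewrite -/A in m_gt0; move=> h; rewrite -(pmulr_rgt0 _ m_gt0) -h.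
    by rewrite ltr_wpDl ?sqr_ge0 ?mulr_gt0.
  - by rewrite -det_eq /tdet; ring.
have [j hj] := exists_centered_shift t a_gt0.
apply: (Pshear21 (k := j)); apply: Pswap12; apply: IHn.
- have : a * (b + 2 * j * t + j ^+ 2 * a) = A + (t + j * a) ^+ 2 by rewrite /A; ring.
  rewrite -/A in m_gt0.
  move: (b + _ + _) (t + _) hj => y x hx hy.
  have hx2 := centered_sqr_le hx.
  have hA2 : 3 * A ^+ 2 <= 12 * a
    by have : a * d <= a * 3; [rewrite ler_pM2l | lia].
  have hAa : A <= a.
    rewrite leNgt; apply/negP => ltaA; have : (a + 1) ^+ 2 <= A ^+ 2 by rewrite lerXn2r ?nnegrE; lia.
    have : a * 2 <= a * a by rewrite ler_pM2l.
    lia.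
  have : a * 2 <= a * a by rewrite ler_pM2l.
  move=> ha2; have : a * y < a * a by lia.
  rewrite ltr_pM2l //; lia.
- have : a * (b + 2 * j * t + j ^+ 2 * a) = A + (t + j * a) ^+ 2 by rewrite /A; ring.
  rewrite -/A in m_gt0; move=> h; rewrite -(pmulr_rgt0 _ a_gt0) h.
  by rewrite ltr_wpDr ?sqr_ge0.
- have -> : (b + 2 * j * t + j ^+ 2 * a) * a - (t + j * a) ^+ 2 = A by rewrite /A; ring.
  by [].
- by rewrite -det_eq /tdet; ring.
Qed.
End Reduction.

(** Gauss reduction ends with A <= 2. For A = 1 the form is u^2 + d v^2; A = 2 is impossible for d =
    1, and for d = 3 the value 2 at (1, 0) is excluded by the hypothesis modulo 3. *)
Lemma binary_form_represents (d A B C : int) :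
    0 < A -> A * C - B ^+ 2 = d ->
    d = 1 \/ d = 3 /\ (forall y z k : int, A * y ^+ 2 + 2 * B * y * z + C * z ^+ 2 <> 3 * k + 2) ->
  forall y z : int, exists u v : int, A * y ^+ 2 + 2 * B * y * z + C * z ^+ 2 = u ^+ 2 + d * v ^+ 2.
Proof.
have [n] := ubnP `|A|%N; elim: n => // n IHn in A B C *.
rewrite ltnS => A_le_n A_gt0 det_eq Hd y z.
have d_gt0 : 0 < d by lia.
have [k hk] := exists_centered_shift B A_gt0.
have [x xE] : exists x : int, x = B + k * A by exists (B + k * A).
have [D DE] : exists D : int, D = C + 2 * k * B + k ^+ 2 * A by exists (C + 2 * k * B + k ^+ 2 * A).
have hD : A * D = x ^+ 2 + d by rewrite -det_eq DE xE; ring.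
have D_gt0 : 0 < D by rewrite -(pmulr_rgt0 _ A_gt0) hD ltr_wpDl ?sqr_ge0.
rewrite -xE in hk; have hx := centered_sqr_le hk.
have reE (y' z' : int) : D * z' ^+ 2 + 2 * x * z' * y' + A * y' ^+ 2 =
    A * (y' + k * z') ^+ 2 + 2 * B * (y' + k * z') * z' + C * z' ^+ 2.
  by rewrite DE xE; ring.
have [hA|hA] := lerP (3 * A ^+ 2) (4 * d); last first.
  have ltDA : D < A by rewrite -(ltr_pM2l A_gt0); lia.
  have [|||u [v uv]] := IHn D x A _ D_gt0 _ _ z (y - k * z).
  - by lia.
  - by rewrite mulrC hD addrAC subrr add0r.
  - case: Hd => [->|[-> Hd]]; [by left|right; split=> // z' y' j].
    by rewrite reE; apply: Hd.
  by exists u, v; rewrite -uv reE; congr (A * _ ^+ 2 + 2 * B * _ * z + _); ring.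
have A_le2 : A <= 2.
  rewrite leNgt; apply/negP => lt2A; have : 3 ^+ 2 <= A ^+ 2 by rewrite lerXn2r ?nnegrE; lia.
  lia.
have yE : y = (y - k * z) + k * z by ring.
have [A1|A2] : A = 1 \/ A = 2 by lia.
  have x0 : x = 0 by lia.
  exists (y - k * z), z; rewrite {1 2}yE -reE.
  by move: hD; rewrite A1 x0 mul1r expr0n add0r => ->; ring.
exfalso; case: Hd => [d1|[d3 Hd]]; first by rewrite A2 d1 in hA.
by apply: (Hd 1 0 0); rewrite A2; ring.
Qed.

Lemma ternary_det1_represents (a b c r s t : int) :
    0 < a -> 0 < a * b - t ^+ 2 -> tdet a b c r s t = 1 ->
  forall x y z : int, exists u v w : int, tform a b c r s t x y z = u ^+ 2 + v ^+ 2 + w ^+ 2.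
Proof.
pose P a b c r s t := forall x y z : int, exists u v w : int,
  tform a b c r s t x y z = u ^+ 2 + v ^+ 2 + w ^+ 2.
apply: (@ternary_reduction P) => //; rewrite /P /tform.
- by move=> a' b' c' r' s' t' h x y z; have [u [v [w e]]] := h y x z; exists u, v, w; rewrite -e; ring.
- by move=> a' b' c' r' s' t' h x y z; have [u [v [w e]]] := h x z y; exists u, v, w; rewrite -e; ring.
- move=> k a' b' c' r' s' t' h x y z.
  by have [u [v [w e]]] := h (x - k * y) y z; exists u, v, w; rewrite -e; ring.
- move=> k a' b' c' r' s' t' h x y z.
  by have [u [v [w e]]] := h x (y - k * z) z; exists u, v, w; rewrite -e; ring.
move=> b' c' r' b_gt0 det_eq x y z.
have [|u [v uv]] := @binary_form_represents 1 b' r' c' b_gt0 det_eq _ y z; first by left.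
by exists x, u, v; rewrite mul1r in uv; rewrite -(addrA (x ^+ 2)) -uv; ring.
Qed.

(* The adjoint form distinguishes the two classes of determinant 3: for
   x^2 + 2 (y^2 + y z + z^2) it takes the value 2. *)
Lemma ternary_det3_represents (a b c r s t : int) :
    0 < a -> 0 < a * b - t ^+ 2 -> tdet a b c r s t = 3 ->
    (forall x y z k : int, tform (b * c - r ^+ 2) (a * c - s ^+ 2) (a * b - t ^+ 2)
       (s * t - a * r) (r * t - b * s) (r * s - c * t) x y z <> 3 * k + 2) ->
  forall x y z : int, exists u v w : int, tform a b c r s t x y z = u ^+ 2 + v ^+ 2 + 3 * w ^+ 2.
Proof.
pose P a b c r s t :=
    (forall x y z k : int, tform (b * c - r ^+ 2) (a * c - s ^+ 2) (a * b - t ^+ 2)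
       (s * t - a * r) (r * t - b * s) (r * s - c * t) x y z <> 3 * k + 2) ->
  forall x y z : int, exists u v w : int,
  tform a b c r s t x y z = u ^+ 2 + v ^+ 2 + 3 * w ^+ 2.
apply: (@ternary_reduction P) => //; rewrite /P /tform.
- move=> a' b' c' r' s' t' h ad x y z; have [|u [v [w e]]] := h _ y x z.
    by move=> x' y' z' k; have := ad y' x' z' k; congr (_ <> _); ring.
  by exists u, v, w; rewrite -e; ring.
- move=> a' b' c' r' s' t' h ad x y z; have [|u [v [w e]]] := h _ x z y.
    by move=> x' y' z' k; have := ad x' z' y' k; congr (_ <> _); ring.
  by exists u, v, w; rewrite -e; ring.
- move=> j a' b' c' r' s' t' h ad x y z; have [|u [v [w e]]] := h _ (x - j * y) y z.
    by move=> x' y' z' k; have := ad x' (y' - j * x') z' k; congr (_ <> _); ring.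
  by exists u, v, w; rewrite -e; ring.
- move=> j a' b' c' r' s' t' h ad x y z; have [|u [v [w e]]] := h _ x (y - j * z) z.
    by move=> x' y' z' k; have := ad x' y' (z' - j * y') k; congr (_ <> _); ring.
  by exists u, v, w; rewrite -e; ring.
move=> b' c' r' b_gt0 det_eq ad x y z.
have [|u [v uv]] := @binary_form_represents 3 b' r' c' b_gt0 det_eq _ y z.
  by right; split=> // y' z' k; have := ad 0 (- z') y' k; congr (_ <> _); ring.
by exists x, u, v; rewrite -(addrA (x ^+ 2)) -uv; ring.
Qed.

(** With determinant 3 and a b - t^2 = 1 mod 3, this makes every value of the adjoint form a square
    modulo 3, hence never 2 modulo 3. *)
Lemma adjoint_form_identity (a b c r s t x y z : int) :
  (a * b - t ^+ 2) * tform (b * c - r ^+ 2) (a * c - s ^+ 2) (a * b - t ^+ 2)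
     (s * t - a * r) (r * t - b * s) (r * s - c * t) x y z =
  ((r * t - b * s) * x + (s * t - a * r) * y + (a * b - t ^+ 2) * z) ^+ 2 +
  tdet a b c r s t * (b * x ^+ 2 - 2 * t * x * y + a * y ^+ 2).
Proof. by rewrite /tform /tdet; ring. Qed.

(** * Quadratic reciprocity *)

Lemma Fp_exp_prime p (x : 'F_p) : prime p -> x ^+ p = x.
Proof. by move=> p_pr; have := expf_card x; rewrite card_Fp. Qed.

Lemma Fp_fermat p (x : 'F_p) : prime p -> x != 0 -> x ^+ p.-1 = 1.
Proof.
move=> p_pr x_neq0; apply: (mulfI x_neq0).
by rewrite mulr1 -exprS prednK ?prime_gt0 // Fp_exp_prime.
Qed.

Lemma Fp_prim_root p : prime p -> exists g : 'F_p, p.-1.-primitive_root g.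
Proof.
move=> p_pr; have p_gt1 := prime_gt1 p_pr.
have : has p.-1.-primitive_root (enum (predC1 (0 : 'F_p))).
  apply: has_prim_root; rewrite ?enum_uniq //; first by rewrite -ltnS prednK // prime_gt0.
    by apply/allP => x; rewrite mem_enum unity_rootE => x_neq0; rewrite Fp_fermat.
  by rewrite -cardE cardC1 card_Fp.
by case/hasP => g _ g_prim; exists g.
Qed.

Lemma half_prime p : prime p -> odd p -> p.-1 = (2 * p./2)%N.
Proof. by lia. Qed.

Definition legendre p (a : 'F_p) : int :=
  if a == 0 then 0 else if a ^+ p./2 == 1 then 1 else -1.

Definition is_sign0 (x : int) := [|| x == 0, x == 1 | x == -1].

Lemma legendre_sign0 p (a : 'F_p) : is_sign0 (legendre a).
Proof. by rewrite /legendre; case: ifP => // _; case: ifP. Qed.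

Lemma is_sign0M x y : is_sign0 x -> is_sign0 y -> is_sign0 (x * y).
Proof. by case/or3P=> /eqP->; case/or3P=> /eqP->. Qed.

Lemma is_sign0X x n : is_sign0 x -> is_sign0 (x ^+ n).
Proof. by move=> sx; elim: n => // n; rewrite exprS; apply: is_sign0M. Qed.

Lemma is_sign0_inj (F : fieldType) x y : (2 : F) != 0 ->
  is_sign0 x -> is_sign0 y -> x%:~R = y%:~R :> F -> x = y.
Proof.
move=> two_neq0; have one_neq0 := oner_neq0 F.
case/or3P=> /eqP->; case/or3P=> /eqP-> //= /eqP;
  rewrite ?rmorph0 ?rmorphN ?rmorph1 -subr_eq0 ?sub0r ?subr0 ?opprK ?oppr_eq0 ?oner_eq0 //;
  by rewrite -?opprD ?oppr_eq0 -mulr2n (negPf two_neq0).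
Qed.

Section Legendre.
Variable p : nat.
Hypotheses (p_pr : prime p) (p_odd : odd p).
Local Notation F := 'F_p.

Lemma Fp_two_neq0 : (2 : F) != 0.
Proof.
rewrite -[2]/(2%:R) -(dvdn_pcharf (pchar_Fp p_pr)) gtnNdvd //.
by have := prime_gt1 p_pr; move: p_odd; lia.
Qed.

Lemma legendreE (a : F) : (legendre a)%:~R = a ^+ p./2.
Proof.
rewrite /legendre; have [->|a_neq0] := eqVneq.
  by rewrite expr0n eqn0Ngt half_gt0 prime_gt1.
have [-> //|/eqP neq1] := eqVneq.
have : (a ^+ p./2 - 1) * (a ^+ p./2 + 1) == 0.
  rewrite -subr_sqr expr1n -exprM mulnC -half_prime //.
  by rewrite Fp_fermat ?subrr.
by rewrite mulf_eq0 subr_eq0 (introF eqP neq1) addr_eq0 /= => /eqP->.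
Qed.

Lemma legendre_eq (a : F) x : is_sign0 x -> x%:~R = a ^+ p./2 -> legendre a = x.
Proof. by move=> sx eq; apply: (is_sign0_inj Fp_two_neq0); rewrite ?legendre_sign0 // legendreE. Qed.

Lemma legendreM (a b : F) : legendre (a * b) = legendre a * legendre b.
Proof.
by apply: legendre_eq; rewrite ?is_sign0M ?legendre_sign0 // rmorphM /= !legendreE exprMn.
Qed.

Lemma legendre1 : legendre (1 : F) = 1.
Proof. by rewrite /legendre oner_eq0 expr1n eqxx. Qed.

Lemma legendre_eq0 (a : F) : (legendre a == 0) = (a == 0).
Proof. by rewrite /legendre; case: (eqVneq a 0) => // _; case: ifP. Qed.

Lemma legendre_sqrt (a : F) : legendre a = 1 -> exists x : F, a = x ^+ 2.
Proof.
move=> a1; have [g g_prim] := Fp_prim_root p_pr.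
have := legendreE a; rewrite a1 => /esym ah.
have [|i ai] := prim_rootP g_prim (x := a); first by rewrite half_prime // mulnC exprM ah expr1n.
move/eqP: ah; rewrite ai -exprM -(prim_order_dvd g_prim); move: (nat_of_ord i) => {ai}j.
rewrite half_prime // dvdn_pmul2r.
  by case/dvdnP=> k ->; exists (g ^+ k); rewrite exprM.
by rewrite half_gt0 prime_gt1.
Qed.

Lemma sum_legendre : \sum_(a : F) legendre a = 0.
Proof.
have [g g_prim] := Fp_prim_root p_pr.
have h_gt0 : (0 < p./2)%N by rewrite half_gt0 prime_gt1.
have g_neq0 : g != 0.
  apply/eqP => g0; have := prim_expr_order g_prim.
  by rewrite g0 expr0n half_prime // eqn0Ngt muln_gt0 h_gt0 => /eqP; rewrite eq_sym oner_eq0.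
have lg : legendre g = -1.
  rewrite /legendre (negPf g_neq0) -(prim_order_dvd g_prim) half_prime //.
  by rewrite gtnNdvd //; lia.
have : \sum_(a : F) legendre a = \sum_(a : F) legendre (g * a).
  rewrite (reindex_inj (h := *%R g)) //; exact: mulfI.
under [in RHS]eq_bigr => a _ do rewrite legendreM lg mulN1r.
by rewrite sumrN; move: (\sum_(a : F) _) => S; lia.
Qed.
End Legendre.

Lemma exists_closure p : prime p -> exists (K : closedFieldType) (f : {rmorphism 'F_p -> K}), p \in [pchar K].
Proof.
move=> p_pr; have [K [f _]] := countable_algebraic_closure 'F_p.
by exists K, f; rewrite (rmorph_pchar f) // pchar_Fp.
Qed.

Section GaussSum.
Variables l p : nat.
Hypotheses (l_pr : prime l) (l_odd : odd l) (p_pr : prime p) (p_odd : odd p) (neq_lp : l != p).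

(** Let z be a nontrivial l-th root of unity in an algebraic closure of F_p. The Gauss sum g of (a /
    l) z^a satisfies g^2 = (-1 / l) l and, by Frobenius, g^p = (p / l) g; comparing with g^(p - 1) =
    (g^2)^((p - 1) / 2) gives the claim. *)
Lemma legendre_gauss :
  legendre (p%:R : 'F_l) = legendre ((legendre (-1 : 'F_l) * l%:Z)%:~R : 'F_p).
Proof.
have [K [f pK]] := exists_closure p_pr.
have l_neq0 : (l%:R : K) != 0.
  by rewrite -(dvdn_pcharf pK) dvdn_prime2 // eq_sym.
have [z z_l z_neq1] : exists2 z : K, z ^+ l = 1 & z != 1.
  have /closed_rootP[z] : size (\poly_(i < l) (1 : K)) != 1%N.
    by rewrite size_poly_eq ?oner_eq0 // neq_ltn prime_gt1 ?orbT.
  rewrite rootE horner_poly => /eqP; under eq_bigr do rewrite mul1r.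
  move=> z0; exists z; first by apply/eqP; rewrite -subr_eq0 subrX1 z0 mulr0.
  apply/eqP => z1; move: z0; rewrite z1 (eq_bigr (fun=> 1)) => [|i _]; last exact: expr1n.
  by rewrite sumr_const card_ord => /eqP; rewrite (negPf l_neq0).
pose psi (a : 'F_l) : K := z ^+ (a : nat).
have psi_nat n : psi n%:R = z ^+ n.
  by rewrite /psi val_Fp_nat // {2}(divn_eq n l) exprD mulnC exprM z_l expr1n mul1r.
have psi1 : psi 1 = z by rewrite -[1]/(1%:R) psi_nat expr1.
have nat_Fp (a : 'F_l) : (a : nat)%:R = a by apply: natr_Zp.
have psiD a b : psi (a + b) = psi a * psi b.
  by rewrite -[a in LHS]nat_Fp -[b in LHS]nat_Fp -natrD psi_nat exprD.
have sum_psi t : \sum_a psi (a * t) = if t == 0 then l%:R else 0.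
  have [->|t_neq0] := eqVneq t 0.
    under eq_bigr do rewrite mulr0.
    by rewrite sumr_const card_Fp // /psi expr0.
  have -> : \sum_a psi (a * t) = \sum_a psi a.
    by rewrite [RHS](reindex_inj (h := *%R^~ t)) //; apply: mulIf.
  have : psi 1 * \sum_a psi a = \sum_a psi a.
    rewrite mulr_sumr [RHS](reindex_inj (h := +%R 1)) /=; last exact: addrI.
    by apply: eq_bigr => a _; rewrite psiD.
  move/eqP; rewrite -subr_eq0 -{2}[\sum_a _]mul1r -mulrBl mulf_eq0 subr_eq0.
  by rewrite psi1 (negPf z_neq1) => /eqP.
pose g := \sum_(a : 'F_l) (legendre a)%:~R * psi a.
have g2 : g ^+ 2 = (legendre (-1 : 'F_l) * l%:Z)%:~R.
  (* Substituting b = a c in the double sum for g^2 leaves, for each c, the sum of psi (a (c + 1))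
     over nonzero a, which is l - 1 if c = -1 and -1 otherwise. *)
  have inner a : a != 0 ->
      \sum_b (legendre a)%:~R * psi a * ((legendre b)%:~R * psi b) =
      \sum_c (legendre c)%:~R * psi (a * (c + 1)).
    move=> a_neq0; rewrite (reindex_inj (mulfI a_neq0)); apply: eq_bigr => c _.
    rewrite mulrDr mulr1 psiD mulrACA -rmorphM /= legendreM // [psi a * _]mulrC.
    have := legendre_sign0 a; rewrite -(legendre_eq0 a) in a_neq0.
    by rewrite /is_sign0 (negPf a_neq0) /= => /orP[]/eqP->; rewrite ?mulN1r ?opprK ?mul1r.
  rewrite expr2 big_distrlr /= (bigD1 0) //= [X in X + _]big1 ?add0r => [|b _]; last first.
    by rewrite /legendre eqxx !mul0r.
  rewrite (eq_bigr _ inner) exchange_big /=.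
  transitivity (\sum_(c : 'F_l) (legendre c)%:~R * ((if c == -1 then l%:R else 0) - 1 : K)).
    apply: eq_bigr => c _; rewrite -mulr_sumr; congr (_ * _).
    rewrite -addr_eq0 -sum_psi [X in _ = X - _](bigD1 0) //= mul0r /psi expr0.
    by rewrite [RHS]addrC addKr.
  under eq_bigr do rewrite mulrBr mulr1; rewrite sumrB -rmorph_sum /= sum_legendre // subr0.
  rewrite (bigD1 (-1)) //= eqxx big1 ?addr0 => [|c /negPf->]; last by rewrite mulr0.
  by rewrite rmorphM.
have gp : g ^+ p = (legendre (p%:R : 'F_l))%:~R * g.
  rewrite -(pFrobenius_autE pK) rmorph_sum /= mulr_sumr.
  have p_neq0 : (p%:R : 'F_l) != 0.
    by rewrite -(dvdn_pcharf (pchar_Fp l_pr)) dvdn_prime2.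
  rewrite [RHS](reindex_inj (mulIf p_neq0)); apply: eq_bigr => a _.
  rewrite pFrobenius_autE exprMn legendreM // mulrA; congr (_ * _).
    rewrite -rmorphXn -rmorphM /= mulrCA; congr _%:~R.
    have -> : legendre (p%:R : 'F_l) * legendre (p%:R : 'F_l) = 1.
      have := legendre_sign0 (p%:R : 'F_l).
      by rewrite /is_sign0 legendre_eq0 (negPf p_neq0) /= => /orP[]/eqP->.
    rewrite mulr1; have := legendre_sign0 a; case/or3P=> /eqP->.
    - by rewrite expr0n eqn0Ngt prime_gt0.
    - by rewrite expr1n.
    by rewrite -signr_odd p_odd expr1.
  by rewrite -[a in RHS]nat_Fp -natrM psi_nat exprM.
have g_neq0 : g != 0.
  rewrite -sqrf_eq0 g2 rmorphM /= mulf_neq0 //.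
  have : legendre (-1 : 'F_l) != 0 by rewrite legendre_eq0 oppr_eq0 oner_eq0.
  have := legendre_sign0 (-1 : 'F_l).
  case/or3P=> /eqP-> // _; first by rewrite oner_eq0.
  by rewrite -[(-1)%:~R]/(- 1 : K) oppr_eq0 oner_eq0.
apply/esym/legendre_eq; rewrite ?legendre_sign0 //.
apply: (fmorph_inj f); rewrite rmorph_int rmorphXn /= rmorph_int -g2.
by apply: (mulIf g_neq0); rewrite -gp -exprM -half_prime // -exprSr prednK ?prime_gt0.
Qed.
End GaussSum.

Lemma legendreN1 p : prime p -> odd p -> legendre (-1 : 'F_p) = if (p %% 4 == 1)%N then 1 else -1.
Proof.
move=> p_pr p_odd; apply: legendre_eq => //; first by case: ifP.
rewrite -signr_odd; have -> : odd p./2 = ~~ (p %% 4 == 1)%N by lia.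
by case: (_ == _).
Qed.

(** The Gauss sum argument with an 8th root of unity z: g = z + 1/z, written z + z^7, has g^2 = 2,
    and g^p = z^p + z^(-p) is g or -g according to p modulo 8. *)
Lemma legendre2 p : prime p -> odd p ->
  legendre (2 : 'F_p) = if ((p %% 8 == 1) || (p %% 8 == 7))%N then 1 else -1.
Proof.
move=> p_pr p_odd; set e : int := if _ then _ else _; apply: legendre_eq => //; first by rewrite /e; case: ifP.
have [K [f pK]] := exists_closure p_pr.
have [z z4] : exists z : K, z ^+ 4 = -1.
  have /closed_rootP[z] : size ('X^4 + 1 : {poly K}) != 1%N.
    by rewrite -[1]/(1%:P) size_XnaddC.
  by rewrite rootE !hornerE addr_eq0 => /eqP; exists z.
have z8 : z ^+ 8 = 1 by rewrite (exprM z 4 2) z4 sqrrN expr1n.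
pose g := z + z ^+ 7.
have g2 : g ^+ 2 = 2.
  have -> : g ^+ 2 = z ^+ 2 + 2 * z ^+ 8 + z ^+ 2 * z ^+ 8 * z ^+ 4 by rewrite /g; ring.
  by rewrite z8 z4; ring.
have gp : g ^+ p = e%:~R * g.
  rewrite -(pFrobenius_autE pK) rmorphD /= !pFrobenius_autE -!exprM.
  have zE n : z ^+ n = z ^+ (n %% 8)%N by rewrite {1}(divn_eq n 8) exprD mulnC exprM z8 expr1n mul1r.
  rewrite [z ^+ p]zE [z ^+ (7 * p)]zE -modnMmr.
  have : (p %% 8)%N \in [:: 1; 3; 5; 7]%N by rewrite !inE; lia.
  rewrite /e !inE => /or4P[]/eqP-> /=.
  - by rewrite expr1 mul1r.
  - rewrite -[(21 %% 8)%N]/5%N /g.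
    have -> : z ^+ 7 = z ^+ 3 * z ^+ 4 by ring.
    have -> : z ^+ 5 = z * z ^+ 4 by ring.
    by rewrite z4; ring.
  - rewrite -[(35 %% 8)%N]/3%N /g.
    have -> : z ^+ 7 = z ^+ 3 * z ^+ 4 by ring.
    have -> : z ^+ 5 = z * z ^+ 4 by ring.
    by rewrite z4; ring.
  by rewrite -[(49 %% 8)%N]/1%N /g mul1r expr1 addrC.
have g_neq0 : g != 0.
  by rewrite -sqrf_eq0 g2 -(rmorph_nat f 2) fmorph_eq0 Fp_two_neq0.
apply: (fmorph_inj f); rewrite rmorph_int rmorphXn /= rmorph_nat -g2.
by apply: (mulIf g_neq0); rewrite -gp -exprM -half_prime // -exprSr prednK ?prime_gt0.
Qed.

Lemma legendre_nat_eq0 p n : prime p -> (legendre (n%:R : 'F_p) == 0) = (p %| n)%N.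
Proof. by move=> p_pr; rewrite legendre_eq0 (dvdn_pcharf (pchar_Fp p_pr)). Qed.

Lemma legendre_sqr p (a : 'F_p) : a != 0 -> legendre a * legendre a = 1.
Proof.
move=> a_neq0; have := legendre_sign0 a.
by rewrite /is_sign0 legendre_eq0 (negPf a_neq0) /= => /orP[]/eqP->.
Qed.

Lemma legendre_modn p a b : prime p -> (a = b %[mod p])%N ->
  legendre (a%:R : 'F_p) = legendre (b%:R : 'F_p).
Proof. by move=> p_pr eq; congr legendre; apply: val_inj; rewrite /= !val_Fp_nat. Qed.

Lemma quadratic_reciprocity l p : prime l -> odd l -> prime p -> odd p -> l != p ->
  legendre (l%:R : 'F_p) =
  legendre (p%:R : 'F_l) * (if ((l %% 4 == 3) && (p %% 4 == 3))%N then -1 else 1).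
Proof.
move=> l_pr l_odd p_pr p_odd neq_lp; rewrite (legendre_gauss l_pr l_odd p_pr p_odd neq_lp) legendreN1 //.
have [l4|l4] : (l %% 4 = 1 \/ l %% 4 = 3)%N by lia.
  by rewrite l4 mulr1 mul1r -pmulrn.
rewrite l4 /= mulN1r rmorphN /= -pmulrn -mulN1r legendreM // legendreN1 //.
by have [->|->] : (p %% 4 = 1 \/ p %% 4 = 3)%N; [lia|rewrite mul1r mulr1|rewrite mulrN1 mulN1r opprK].
Qed.

(** * The Kronecker symbol as a periodic multiplicative function *)

Definition chi4 (q : nat) : int := if odd q then if (q %% 4 == 1)%N then 1 else -1 else 0.

Definition chi8 (q : nat) : int :=
  if odd q then if ((q %% 8 == 1) || (q %% 8 == 7))%N then 1 else -1 else 0.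

(* The Jacobi symbol (l / q) for odd q, written through reciprocity so that it is
   visibly periodic in q. *)
Definition prime_symbol (l q : nat) : int :=
  if l == 2%N then chi8 q else
  if odd q then legendre (q%:R : 'F_l) * (if ((l %% 4 == 3) && (q %% 4 == 3))%N then -1 else 1)
  else 0.

Lemma chi4_sign0 q : is_sign0 (chi4 q).
Proof. by rewrite /chi4; case: odd => //; case: ifP. Qed.

Lemma chi4M a b : chi4 (a * b) = chi4 a * chi4 b.
Proof.
rewrite /chi4 oddM; case: (boolP (odd a)) => [a_odd|]; last by rewrite mul0r.
case: (boolP (odd b)) => [b_odd|]; last by rewrite mulr0.
rewrite -modnMm; have [->|->] : (a %% 4 = 1 \/ a %% 4 = 3)%N by lia.
  by rewrite mul1n modn_mod mul1r.
by have [->|->] : (b %% 4 = 1 \/ b %% 4 = 3)%N by lia.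
Qed.

Lemma chi8M a b : chi8 (a * b) = chi8 a * chi8 b.
Proof.
rewrite /chi8 oddM; case: (boolP (odd a)) => [a_odd|]; last by rewrite mul0r.
case: (boolP (odd b)) => [b_odd|]; last by rewrite mulr0.
rewrite -modnMm.
have : (a %% 8 \in [:: 1; 3; 5; 7])%N by rewrite !inE; lia.
have : (b %% 8 \in [:: 1; 3; 5; 7])%N by rewrite !inE; lia.
by rewrite !inE => /or4P[]/eqP-> /or4P[]/eqP->.
Qed.

Section PrimeSymbol.
Variable l : nat.
Hypothesis l_pr : prime l.

Let l_odd : l != 2%N -> odd l.
Proof. by move=> l2; case: (even_prime l_pr) l2 => // ->. Qed.

Lemma prime_symbol_sign0 q : is_sign0 (prime_symbol l q).
Proof.
rewrite /prime_symbol /chi8; case: ifP => _; first by case: odd => //; case: ifP.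
by case: ifP => // _; rewrite is_sign0M ?legendre_sign0 //; case: ifP.
Qed.

Lemma prime_symbol1 : prime_symbol l 1 = 1.
Proof. by rewrite /prime_symbol; case: ifP => // _; rewrite legendre1 andbF. Qed.

Lemma prime_symbolM a b : prime_symbol l (a * b) = prime_symbol l a * prime_symbol l b.
Proof.
rewrite /prime_symbol; case: (eqVneq l 2%N) => [_|/l_odd lo]; first exact: chi8M.
rewrite oddM; case: (boolP (odd a)) => [a_odd|]; last by rewrite mul0r.
case: (boolP (odd b)) => [b_odd|]; last by rewrite mulr0.
rewrite natrM legendreM // mulrACA; congr (_ * _).
case: (l %% 4 == 3)%N => //=; rewrite -modnMm.
have [->|->] : (a %% 4 = 1 \/ a %% 4 = 3)%N by lia.
  by rewrite mul1n modn_mod mul1r.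
by have [->|->] : (b %% 4 = 1 \/ b %% 4 = 3)%N by lia.
Qed.

Lemma prime_symbol_modn a b : (a = b %[mod 8 * l])%N -> prime_symbol l a = prime_symbol l b.
Proof.
move=> eq_ab; have eq8 : (a = b %[mod 8])%N by rewrite -(modn_dvdm a (dvdn_mulr l (dvdnn 8))) eq_ab modn_dvdm ?dvdn_mulr.
have eql : (a = b %[mod l])%N by rewrite -(modn_dvdm a (dvdn_mull 8 (dvdnn l))) eq_ab modn_dvdm ?dvdn_mull.
have odd_ab : odd a = odd b by clear -eq8; lia.
rewrite /prime_symbol /chi8 odd_ab eq8 (legendre_modn l_pr eql).
by have -> : (a %% 4 = b %% 4)%N by clear -eq8; lia.
Qed.

Lemma prime_symbol_neq0 q : odd q -> ~~ (l %| q)%N -> prime_symbol l q != 0.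
Proof.
move=> q_odd ndiv; rewrite /prime_symbol /chi8 q_odd.
case: ifP => _; first by case: ifP.
by rewrite mulf_neq0 ?legendre_nat_eq0 //; case: ifP.
Qed.

Lemma prime_symbol_prime p : prime p -> odd p -> l != p -> prime_symbol l p = legendre (l%:R : 'F_p).
Proof.
move=> p_pr p_odd neq_lp; rewrite /prime_symbol /chi8 p_odd.
case: eqVneq => [->|/l_odd lo]; first by rewrite legendre2.
by rewrite (quadratic_reciprocity l_pr lo p_pr p_odd neq_lp).
Qed.
End PrimeSymbol.

Section MultiplicativeExtension.
Variables (R : comPzRingType) (g : nat -> R).

Definition mult_ext n : R := \prod_(p <- primes n) g p ^+ logn p n.

Lemma mult_ext_widen n N : (0 < n <= N)%N ->
  mult_ext n = \prod_(0 <= p < N.+1 | prime p) g p ^+ logn p n.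
Proof.
case/andP=> n_gt0 le_nN; rewrite (bigID (fun p => p \in primes n)) /= [X in _ * X]big1 ?mulr1.
  rewrite -big_filter; apply: perm_big; apply: uniq_perm; rewrite ?primes_uniq ?filter_uniq ?iota_uniq // => p.
  rewrite mem_filter mem_index_iota andbC; case: (boolP (p \in primes n)) => [|_]; last by rewrite !andbF.
  by rewrite mem_primes => /and3P[-> _ dv]; rewrite ltnS (leq_trans (dvdn_leq n_gt0 dv) le_nN).
by move=> p /andP[p_pr]; rewrite mem_primes p_pr n_gt0 /= => ndv; rewrite lognE p_pr n_gt0 (negPf ndv).
Qed.

Lemma mult_extM m n : (0 < m)%N -> (0 < n)%N -> mult_ext (m * n) = mult_ext m * mult_ext n.
Proof.
move=> m_gt0 n_gt0; have mn_gt0 : (0 < m * n)%N by rewrite muln_gt0 m_gt0.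
rewrite !(@mult_ext_widen _ (m * n)) ?m_gt0 ?n_gt0 ?mn_gt0 ?leqnn ?leq_pmulr ?leq_pmull //.
by rewrite -big_split; apply: eq_bigr => p p_pr; rewrite lognM // exprD.
Qed.

Lemma mult_ext_prime p : prime p -> mult_ext p = g p.
Proof. by move=> p_pr; rewrite /mult_ext primes_prime // big_seq1 logn_prime // eqxx expr1. Qed.

Lemma mult_ext_eq (f : nat -> R) n : (0 < n)%N -> f 1%N = 1 -> (forall a b, f (a * b)%N = f a * f b) ->
  (forall p, prime p -> (p %| n)%N -> g p = f p) -> mult_ext n = f n.
Proof.
move=> n_gt0 f1 fM gf.
have fX p k : f (p ^ k)%N = f p ^+ k by elim: k => // k IHk; rewrite expnS fM IHk exprS.
rewrite [in RHS](prod_prime_decomp n_gt0) prime_decompE big_map /mult_ext.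
rewrite (big_morph f fM f1) /=; apply: eq_big_seq => p.
by rewrite mem_primes => /and3P[p_pr _ dv]; rewrite fX gf.
Qed.
End MultiplicativeExtension.

(* The Kronecker symbol (-4 D / q). *)
Definition chi D q : int := chi4 q * mult_ext (prime_symbol^~ q) D.

Section Chi.
Variable D : nat.
Hypothesis D_gt0 : (0 < D)%N.

Lemma chi_sign0 q : is_sign0 (chi D q).
Proof.
rewrite is_sign0M ?chi4_sign0 // /mult_ext big_seq.
apply: (big_ind is_sign0) => // [x y|p]; first exact: is_sign0M.
by rewrite mem_primes => /and3P[p_pr _ _]; rewrite is_sign0X ?prime_symbol_sign0.
Qed.

Lemma chi1 : chi D 1 = 1.
Proof.
rewrite /chi mul1r /mult_ext big_seq big1 // => p.
by rewrite mem_primes => /and3P[p_pr _ _]; rewrite prime_symbol1 ?expr1n.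
Qed.

Lemma chiM a b : chi D (a * b) = chi D a * chi D b.
Proof.
rewrite /chi chi4M mulrACA /mult_ext -big_split; congr (_ * _); apply: eq_big_seq => p.
by rewrite mem_primes => /and3P[p_pr _ _]; rewrite prime_symbolM // exprMn.
Qed.

Lemma chi_modn a b : (a = b %[mod 8 * D])%N -> chi D a = chi D b.
Proof.
move=> eq_ab; rewrite /chi /chi4.
have eq8 : (a = b %[mod 8])%N by rewrite -(modn_dvdm a (dvdn_mulr D (dvdnn 8))) eq_ab modn_dvdm ?dvdn_mulr.
have -> : odd a = odd b by clear -eq8; lia.
have -> : (a %% 4 = b %% 4)%N by clear -eq8; lia.
congr (_ * _); apply: eq_big_seq => p; rewrite mem_primes => /and3P[p_pr _ dv].
have dv8 : (8 * p %| 8 * D)%N by rewrite dvdn_pmul2l.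
by rewrite (prime_symbol_modn p_pr (b := b)) // -(modn_dvdm a dv8) eq_ab modn_dvdm.
Qed.

Lemma chi_neq0 q : coprime q (8 * D) -> chi D q != 0.
Proof.
rewrite coprimeMr -[8%N]/(2 ^ 3)%N coprime_pexpr // => /andP[cop2 copD].
have q_odd : odd q by rewrite coprimen2 in cop2.
rewrite mulf_neq0 //; first by rewrite /chi4 q_odd; case: ifP.
rewrite /mult_ext big_seq; apply: (big_ind (fun x => x != 0)) => // [x y|p]; first exact: mulf_neq0.
rewrite mem_primes => /and3P[p_pr _ dv]; rewrite expf_neq0 // prime_symbol_neq0 //.
apply/negP => dvq; have : (p %| gcdn q D)%N by rewrite dvdn_gcd dvq.
by rewrite (eqP copD) dvdn1 => /eqP p1; rewrite p1 in p_pr.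
Qed.

(** Reciprocity turns the symbols of the primes l dividing D back into (l / p), and [chi4] supplies
    (-1 / p). Thus chi(p) = 1 makes -D a square modulo p. *)
Lemma chi_prime p : prime p -> odd p -> ~~ (p %| D)%N -> chi D p = legendre (- D%:R : 'F_p).
Proof.
move=> p_pr p_odd ndv.
rewrite /chi (@mult_ext_eq _ _ (fun n => legendre (n%:R : 'F_p))) //.
- rewrite -mulN1r legendreM // legendreN1 //; congr (_ * _).
  by rewrite /chi4 p_odd.
- exact: legendre1.
- by move=> a b; rewrite natrM legendreM.
move=> l l_pr dv; rewrite prime_symbol_prime //; apply/eqP => eq_lp.
by rewrite -eq_lp dv in ndv.
Qed.
End Chi.

(** Here q = 2m - 1 is 1 modulo 4 and -1 modulo each prime l dividing m, so these primes contribute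
    the product of (-1 / l), which is [chi4 m]; the prime 2 contributes [chi8 q], again equal to
    [chi4 m]. *)
Lemma chi_double_pred m : odd m -> chi (2 * m) (2 * m - 1) = 1.
Proof.
move=> m_odd; have m_gt0 : (0 < m)%N by case: m m_odd.
have q_odd : odd (2 * m - 1) by lia.
have q4 : ((2 * m - 1) %% 4 = 1)%N by lia.
rewrite /chi /chi4 q_odd q4 mul1r mult_extM // mult_ext_prime // (@mult_ext_eq _ _ chi4) //; last first.
- move=> l l_pr dv; have l_odd : odd l := dvdn_odd dv m_odd.
  rewrite /prime_symbol; case: eqP l_odd => [-> //|_ l_odd]; rewrite q_odd q4 andbF mulr1.
  have -> : (2 * m - 1)%:R = -1 :> 'F_l.
    rewrite natrB ?muln_gt0 // natrM; case/dvdnP: dv => k ->.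
    by rewrite natrM pchar_Fp_0 // !mulr0 sub0r.
  by rewrite legendreN1 // /chi4 l_odd.
- exact: chi4M.
rewrite /prime_symbol /chi8 /chi4 /= q_odd m_odd.
by have [h|h] : (m %% 4 = 1 \/ m %% 4 = 3)%N; [lia | |]; rewrite h; case: ifP => //; lia.
Qed.

(** The factor 16 forces q = 5 mod 16 whatever the parity of m. For odd l dividing m, 3q = -1 mod l
    gives (q / l) = (-3 / l) = (l / 3); the prime 2 also contributes (2 / 3) = -1. The product is (m
    / 3) = 1. *)
Lemma chi_sixteen_thirds m q : (m %% 3 = 1)%N -> (3 * q + 1 = 16 * m)%N -> chi m q = 1.
Proof.
move=> m3 qm; have m_gt0 : (0 < m)%N by case: m m3 qm.
have q_odd : odd q by lia.
have q4 : (q %% 4 = 1)%N by lia.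
have q8 : (q %% 8 = 5)%N by lia.
rewrite /chi /chi4 q_odd q4 mul1r (@mult_ext_eq _ _ (fun n => legendre (n%:R : 'F_3))) //.
- by rewrite (@legendre_modn 3 m 1) // legendre1.
- by move=> a b; rewrite natrM legendreM.
move=> l l_pr dv; rewrite /prime_symbol /chi8 q_odd q4 q8 andbF mulr1.
case: eqVneq => [->|l2]; first by rewrite legendre2.
have l_odd : odd l by case: (even_prime l_pr) l2 => // ->.
have l3 : l != 3 by apply: contra_eqN m3 => /eqP l3; rewrite l3 in dv; lia.
have q_eq : legendre (3%:R : 'F_l) * legendre (q%:R : 'F_l) = legendre (-1 : 'F_l).
  rewrite -legendreM // -natrM; congr legendre; apply/eqP; rewrite -addr_eq0 -[1]/(1%:R) -natrD qm.
  by rewrite -(dvdn_pcharf (pchar_Fp l_pr)) dvdn_mull.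
have three_neq0 : (3%:R : 'F_l) != 0.
  by rewrite -(dvdn_pcharf (pchar_Fp l_pr)) dvdn_prime2.
rewrite -[LHS]mul1r -(legendre_sqr three_neq0) -mulrA q_eq legendreN1 //.
rewrite (quadratic_reciprocity (l := 3) _ _ l_pr) 1?eq_sym //=.
by have [->|->] : (l %% 4 = 1 \/ l %% 4 = 3)%N; [lia | rewrite !mulr1 | rewrite !mulrN1 opprK].
Qed.

(** * Divisor sums of a quadratic character in a residue class *)

Section PeriodicSums.
Variables (R : realFieldType) (k : nat).
Hypothesis k_gt0 : (0 < k)%N.

Lemma sum_blocks (f : nat -> R) J :
  \sum_(0 <= e < k * J) f e = \sum_(0 <= i < J) \sum_(0 <= r < k) f (k * i + r)%N.
Proof.
elim: J => [|J IHJ]; first by rewrite muln0 !big_geq.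
rewrite mulnSr (big_cat_nat _ (n := (k * J)%N)) ?leq_addr //= IHJ big_nat_recr //=; congr (_ + _).
rewrite -{1}[(k * J)%N]add0n big_addn addKn.
by apply: eq_bigr => r _; rewrite addnC.
Qed.

Lemma expr_lipschitz (x y : R) n : 0 <= x <= 1 -> 0 <= y <= 1 -> `|x ^+ n - y ^+ n| <= n%:R * `|x - y|.
Proof.
move=> hx hy; rewrite subrXX normrM mulrC ler_wpM2r //.
apply: le_trans (ler_norm_sum _ _ _) _.
rewrite -[n in n%:R]card_ord -sumr_const ler_sum // => i _.
by rewrite normrM !normrX !ger0_norm ?mulr_ile1 ?exprn_ge0 ?exprn_ile1 //; lra.
Qed.

Definition geom (u : R) := \sum_(i < k) u ^+ i.

Lemma geom_ge1 u : 0 <= u -> 1 <= geom u.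
Proof.
move=> u_ge0; rewrite /geom; case: k k_gt0 => // k' _; rewrite big_ord_recl expr0 lerDl.
by rewrite sumr_ge0 // => i _; rewrite exprn_ge0.
Qed.

(** Summing a k-periodic sequence of mean zero against u^e produces these quotients: the pole of 1 /
    (1 - u^k) at u = 1 cancels, which leaves functions that are Lipschitz on [0, 1]. *)
Definition weight j (u : R) := u ^+ j / geom u.

Lemma weight_ge0 j u : 0 <= u -> 0 <= weight j u.
Proof.
by move=> u_ge0; rewrite divr_ge0 ?exprn_ge0 // (le_trans ler01) ?geom_ge1.
Qed.

Lemma weight_le1 j u : 0 <= u <= 1 -> weight j u <= 1.
Proof.
case/andP=> u_ge0 u_le1; have W := geom_ge1 u_ge0.
rewrite ler_pdivrMr ?(lt_le_trans ltr01) // mul1r (le_trans _ W) // exprn_ile1 //.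
Qed.

Lemma weight_lipschitz j x y : (j <= k)%N -> 0 <= x <= 1 -> 0 <= y <= 1 ->
  `|weight j x - weight j y| <= 2 * k%:R ^+ 2 * `|x - y|.
Proof.
move=> le_jk hx hy.
have Wx : 1 <= geom x by apply: geom_ge1; lra.
have Wy : 1 <= geom y by apply: geom_ge1; lra.
have -> : weight j x - weight j y = (x ^+ j * geom y - y ^+ j * geom x) / (geom x * geom y).
  by rewrite /weight; field; rewrite !gt_eqF //; lra.
rewrite normrM normfV [X in _ / X]ger0_norm; last by rewrite mulr_ge0 //; lra.
apply: (@le_trans _ _ `|x ^+ j * geom y - y ^+ j * geom x|).
  rewrite ler_pdivrMr; last by rewrite mulr_gt0 //; lra.
  rewrite ler_peMr // -[1]mulr1 ler_pM //; lra.
rewrite /geom !mulr_sumr -sumrB; apply: le_trans (ler_norm_sum _ _ _) _.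
have -> : 2 * k%:R ^+ 2 * `|x - y| = \sum_(i < k) (2 * k%:R * `|x - y|) :> R.
  by rewrite sumr_const card_ord -mulr_natl; ring.
apply: ler_sum => i _.
have -> : x ^+ j * y ^+ i - y ^+ j * x ^+ i =
   x ^+ j * (y ^+ i - x ^+ i) + x ^+ i * (x ^+ j - y ^+ j) by ring.
apply: le_trans (ler_normD _ _) _; rewrite !normrM.
have hX n : `|x ^+ n| <= 1 by rewrite normrX exprn_ile1 ?normr_ge0 // ger0_norm; lra.
have le1 : `|x ^+ j| * `|y ^+ i - x ^+ i| <= k%:R * `|x - y|.
  apply: (@le_trans _ _ (1 * (i%:R * `|x - y|))).
    by apply: ler_pM => //; rewrite (le_trans (expr_lipschitz _ hy hx)) // distrC.
  by rewrite mul1r ler_wpM2r // ler_nat ltnW.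
have le2 : `|x ^+ i| * `|x ^+ j - y ^+ j| <= k%:R * `|x - y|.
  apply: (@le_trans _ _ (1 * (j%:R * `|x - y|))); first by apply: ler_pM => //; apply: expr_lipschitz.
  by rewrite mul1r ler_wpM2r // ler_nat.
lra.
Qed.

(** On a block of k consecutive indices the mean zero allows subtracting the value of [w] at t^(k
    i); the remaining differences are at most L (t^(k i) - t^(k (i + 1))), and these telescope over
    the blocks. *)
Lemma sum_mean0_lipschitz (b : nat -> R) (w : R -> R) (C L t : R) J :
  0 < t < 1 -> 0 <= C -> 0 <= L ->
  (forall r, b (r + k)%N = b r) -> \sum_(0 <= r < k) b r = 0 -> (forall r, `|b r| <= C) ->
  (forall x y, 0 <= x <= 1 -> 0 <= y <= 1 -> `|w x - w y| <= L * `|x - y|) ->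
  `|\sum_(0 <= d < k * J) b d * w (t ^+ d.+1)| <= k%:R * C * L.
Proof.
move=> ht C_ge0 L_ge0 b_per b_mean b_le w_lip.
have t01 n : 0 <= t ^+ n <= 1 by rewrite exprn_ge0 ?exprn_ile1 //; lra.
have bE i r : b (k * i + r)%N = b r.
  by elim: i => [|i IHi]; rewrite ?muln0 // mulnSr addnAC b_per.
have kCL : 0 <= k%:R * C * L by rewrite !mulr_ge0.
rewrite sum_blocks.
apply: (@le_trans _ _ (\sum_(0 <= i < J) k%:R * C * L * (t ^+ (k * i) - t ^+ (k * i.+1)))); last first.
  rewrite -mulr_sumr ler_piMr // (@telescope_sumr_eq _ _ _ (fun i => - t ^+ (k * i))) //.
    by rewrite muln0 expr0 opprK; have := t01 (k * J)%N; lra.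
  by move=> i _; rewrite opprK addrC.
apply: le_trans (ler_norm_sum _ _ _) _; apply: ler_sum => i _.
have -> : \sum_(0 <= r < k) b (k * i + r)%N * w (t ^+ (k * i + r).+1) =
          \sum_(0 <= r < k) b r * (w (t ^+ (k * i + r).+1) - w (t ^+ (k * i))).
  under [RHS]eq_bigr do rewrite mulrBr.
  rewrite sumrB -mulr_suml b_mean mul0r subr0; apply: eq_bigr => r _; by rewrite bE.
apply: le_trans (ler_norm_sum _ _ _) _.
have -> : k%:R * C * L * (t ^+ (k * i) - t ^+ (k * i.+1)) =
   \sum_(0 <= r < k) C * L * (t ^+ (k * i) - t ^+ (k * i.+1)).
  by rewrite sumr_const_nat subn0 -mulr_natl; ring.
rewrite !big_mkord; apply: ler_sum => r _; rewrite normrM -mulrA ler_pM //.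
apply: le_trans (w_lip _ _ (t01 _) (t01 _)) _; rewrite ler_wpM2l // distrC ger0_norm.
  by rewrite lerB // ler_wiXn2l //; first [lra | rewrite mulnS addnC ltn_add2r].
by rewrite subr_ge0 ler_wiXn2l //; first [lra | rewrite -addnS leq_addr].
Qed.

Lemma abel_geometric (b : nat -> R) (u : R) n :
  (1 - u) * \sum_(0 <= j < n) (\sum_(0 <= i < j.+1) b i) * u ^+ j.+1 =
  \sum_(0 <= j < n) b j * u ^+ j.+1 - (\sum_(0 <= j < n) b j) * u ^+ n.+1.
Proof.
elim: n => [|n IHn]; first by rewrite !big_geq // mulr0 mul0r subrr.
rewrite big_nat_recr //= mulrDr IHn [in RHS]big_nat_recr //= [in RHS]big_nat_recr //= big_nat_recr //=.
by rewrite !exprS; ring.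
Qed.

(** Abel summation over one period yields the factor 1 - u, which cancels against 1 - u^k = (1 - u)
    [geom u]. *)
Lemma periodic_power_sum (b : nat -> R) (u : R) J : 0 <= u < 1 ->
  (forall r, b (r + k)%N = b r) -> \sum_(0 <= r < k) b r = 0 ->
  \sum_(0 <= e < k * J) b e * u ^+ e.+1 =
  (1 - u ^+ (k * J)) * \sum_(0 <= j < k) (\sum_(0 <= i < j.+1) b i) * weight j.+1 u.
Proof.
case/andP=> u_ge0 u_lt1 b_per b_mean.
have bE i r : b (k * i + r)%N = b r.
  by elim: i => [|i IHi]; rewrite ?muln0 // mulnSr addnAC b_per.
have W_neq0 : geom u != 0 by rewrite gt_eqF // (lt_le_trans ltr01) ?geom_ge1.
have u_neq1 : 1 - u != 0 by rewrite subr_eq0 gt_eqF.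
have -> : \sum_(0 <= j < k) (\sum_(0 <= i < j.+1) b i) * weight j.+1 u =
   (\sum_(0 <= j < k) (\sum_(0 <= i < j.+1) b i) * u ^+ j.+1) / geom u.
  by rewrite mulr_suml; apply: eq_bigr => j _; rewrite mulrA.
have P : (1 - u) * \sum_(0 <= j < k) (\sum_(0 <= i < j.+1) b i) * u ^+ j.+1 =
   \sum_(0 <= j < k) b j * u ^+ j.+1 by rewrite abel_geometric b_mean mul0r subr0.
have -> : \sum_(0 <= e < k * J) b e * u ^+ e.+1 =
   (\sum_(i < J) (u ^+ k) ^+ i) * \sum_(0 <= j < k) b j * u ^+ j.+1.
  rewrite sum_blocks big_mkord mulr_suml; apply: eq_bigr => i _; rewrite mulr_sumr; apply: eq_bigr => r _.
  by rewrite bE -addnS exprD exprM mulrCA.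
apply: (mulfI u_neq1); apply: (mulfI W_neq0); rewrite -P.
have G1 : (1 - u) * geom u = 1 - u ^+ k by rewrite /geom -[RHS]opprB subrX1 -mulNr opprB.
have G2 : (1 - u ^+ k) * (\sum_(i < J) (u ^+ k) ^+ i) = 1 - u ^+ (k * J).
  by rewrite exprM -[RHS]opprB subrX1 -mulNr opprB.
rewrite -G2 -G1; field.
exact: W_neq0.
Qed.

(** Summing over e first gives k weights with coefficients bounded by k that still have mean zero in
    d. Each contributes at most k * k * 2 k^2, uniformly in t, whence 2 k^5; the second term comes
    from the factor 1 - u^(k J) of the truncated series. *)
Lemma double_sum_bound (c : nat -> nat -> R) (t : R) J :
  0 < t < 1 ->
  (forall d e, c (d + k)%N e = c d e) -> (forall d e, c d (e + k)%N = c d e) ->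
  (forall d, \sum_(0 <= e < k) c d e = 0) -> (forall e, \sum_(0 <= d < k) c d e = 0) ->
  (forall d e, `|c d e| <= 1) ->
  `|\sum_(0 <= d < k * J) \sum_(0 <= e < k * J) c d e * t ^+ (d.+1 * e.+1)| <=
     2 * k%:R ^+ 5 + k%:R ^+ 2 * (k * J)%:R * t ^+ (k * J).
Proof.
move=> ht per1 per2 mean2 mean1 c_le.
set M := (k * J)%N; pose B j d := \sum_(0 <= i < j.+1) c d i.
have B_le j d : (j < k)%N -> `|B j d| <= k%:R.
  move=> lt_jk; apply: le_trans (ler_norm_sum _ _ _) _.
  apply: (@le_trans _ _ (\sum_(0 <= i < j.+1) 1)); first by apply: ler_sum.
  by rewrite sumr_const_nat subn0 ler_nat.
have t01 n : 0 <= t ^+ n <= 1 by rewrite exprn_ge0 ?exprn_ile1 //; lra.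
have -> : \sum_(0 <= d < M) \sum_(0 <= e < M) c d e * t ^+ (d.+1 * e.+1) =
   \sum_(0 <= j < k) \sum_(0 <= d < M) B j d * weight j.+1 (t ^+ d.+1) -
   \sum_(0 <= d < M) \sum_(0 <= j < k) t ^+ (d.+1 * M) * (B j d * weight j.+1 (t ^+ d.+1)).
  rewrite [X in _ = X - _]exchange_big -sumrB; apply: eq_bigr => d _.
  rewrite [LHS](eq_bigr (fun e => c d e * (t ^+ d.+1) ^+ e.+1)) => [|e _]; last by rewrite exprM.
  rewrite periodic_power_sum //; first by rewrite mulrBl mul1r -exprM mulr_sumr.
  by rewrite exprn_ge0 ?exprn_ilt1 //; lra.
apply: le_trans (ler_normB _ _) _; apply: lerD.
  apply: le_trans (ler_norm_sum _ _ _) _.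
  have -> : 2 * k%:R ^+ 5 = \sum_(0 <= j < k) k%:R * k%:R * (2 * k%:R ^+ 2) :> R.
    by rewrite sumr_const_nat subn0 -mulr_natl; ring.
  rewrite big_nat_cond [X in _ <= X]big_nat_cond; apply: ler_sum => j /andP[/andP[_ lt_jk] _].
  apply: sum_mean0_lipschitz => //.
  - by rewrite mulr_ge0 // exprn_ge0.
  - by move=> d; apply: eq_bigr => i _.
  - by rewrite exchange_big big1 // => i _; apply: mean1.
  - by move=> d; apply: B_le.
  by move=> x y; apply: weight_lipschitz.
apply: le_trans (ler_norm_sum _ _ _) _.
have -> : k%:R ^+ 2 * M%:R * t ^+ M = \sum_(0 <= d < M) \sum_(0 <= j < k) k%:R * t ^+ M.
  rewrite !sumr_const_nat !subn0 -[_ *+ M]mulr_natl -[_ *+ k]mulr_natl; ring.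
apply: ler_sum => d _; apply: le_trans (ler_norm_sum _ _ _) _.
rewrite big_nat_cond [X in _ <= X]big_nat_cond; apply: ler_sum => j /andP[/andP[_ lt_jk] _].
case/andP: (t01 d.+1) => u_ge0 u_le1; have w_ge0 := weight_ge0 j.+1 u_ge0.
rewrite 2!normrM mulrC (ger0_norm w_ge0) ler_pM ?(mulr_ge0 (normr_ge0 _) w_ge0) //.
  by rewrite -[k%:R]mulr1 ler_pM ?B_le // weight_le1 ?u_ge0.
by rewrite ger0_norm; [rewrite ler_wiXn2l ?leq_pmull //; lra | case/andP: (t01 (d.+1 * M)%N)].
Qed.
End PeriodicSums.

Lemma prime_exp_ind (P : nat -> Prop) : P 1%N ->
  (forall p v m, prime p -> (0 < m)%N -> ~~ (p %| m)%N -> P m -> P (p ^ v * m)%N) ->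
  forall n, (0 < n)%N -> P n.
Proof.
move=> P1 PM n; have [N] := ubnP n; elim: N n => // N IHN n; rewrite ltnS => le_nN n_gt0.
have [n_le1|n_gt1] := leqP n 1; first by have -> : n = 1%N by lia.
have [m ndv nE] := pfactor_coprime (pdiv_prime n_gt1) n_gt0.
have m_gt0 : (0 < m)%N by move: n_gt0; rewrite nE muln_gt0 => /andP[].
rewrite nE mulnC; apply: PM => //; [exact: pdiv_prime | by rewrite -prime_coprime ?pdiv_prime|].
apply: IHN => //; apply: leq_trans le_nN; rewrite [X in (_ < X)%N]nE ltn_Pmulr //.
by rewrite -(exp1n (logn (pdiv n) n)) ltn_exp2r ?prime_gt1 ?pdiv_prime // logn_gt0 pi_pdiv.
Qed.

Section DivisorSums.
Variable chi : nat -> int.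
Hypotheses (chi_sign0 : forall q, is_sign0 (chi q)) (chi1 : chi 1 = 1)
  (chiM : forall a b, chi (a * b) = chi a * chi b).

Definition divisor_sum q := \sum_(d <- divisors q) chi d.

Lemma divisor_sum1 : divisor_sum 1 = 1.
Proof. by rewrite /divisor_sum big_seq1. Qed.

Lemma divisor_sum_prime_mul p n : prime p -> (0 < n)%N ->
  divisor_sum (p * n) = chi p * divisor_sum n + \sum_(d <- divisors n | ~~ (p %| d)%N) chi d.
Proof.
move=> p_pr n_gt0; have p_gt0 := prime_gt0 p_pr.
have pn_gt0 : (0 < p * n)%N by rewrite muln_gt0 p_gt0.
rewrite /divisor_sum (bigID (fun d => p %| d)%N) /=; congr (_ + _).
  rewrite -big_filter mulr_sumr (perm_big [seq (p * d)%N | d <- divisors n]) ?big_map //=.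
    by apply: eq_bigr => d _.
  apply: uniq_perm; rewrite ?filter_uniq ?divisors_uniq //.
    by rewrite map_inj_uniq ?divisors_uniq // => a b /eqP; rewrite eqn_pmul2l // => /eqP.
  move=> d; rewrite mem_filter -dvdn_divisors //; apply/andP/mapP => [[/dvdnP[e ->]]|[e]].
    by rewrite mulnC dvdn_pmul2l // => dv; exists e; rewrite -?dvdn_divisors.
  by rewrite -dvdn_divisors // => dv ->; rewrite dvdn_mulr // dvdn_pmul2l.
rewrite -big_filter -[RHS]big_filter; apply: perm_big; apply: uniq_perm; rewrite ?filter_uniq ?divisors_uniq //.
move=> d; rewrite !mem_filter -!dvdn_divisors //; case: (boolP (p %| d)%N) => //= ndv.
by rewrite mulnC Gauss_dvdl // coprime_sym prime_coprime.
Qed.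

Lemma divisor_sum_prime_exp p v m : prime p -> (0 < m)%N -> ~~ (p %| m)%N ->
  divisor_sum (p ^ v * m) = (\sum_(i < v.+1) chi p ^+ i) * divisor_sum m.
Proof.
move=> p_pr m_gt0 ndv.
have T v' : \sum_(d <- divisors (p ^ v' * m) | ~~ (p %| d)%N) chi d = divisor_sum m.
  rewrite /divisor_sum -big_filter; apply: perm_big; apply: uniq_perm; rewrite ?filter_uniq ?divisors_uniq //.
  move=> d; rewrite mem_filter -!dvdn_divisors ?muln_gt0 ?expn_gt0 ?(prime_gt0 p_pr) ?m_gt0 //.
  apply/andP/idP => [[nd]|dv]; first by rewrite Gauss_dvdr // coprimeXr // coprime_sym prime_coprime.
  by rewrite dvdn_mull //; split => //; apply: contra ndv => /dvdn_trans; apply.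
elim: v => [|v IHv]; first by rewrite mul1n big_ord1 mul1r.
rewrite expnS -mulnA divisor_sum_prime_mul ?muln_gt0 ?expn_gt0 ?(prime_gt0 p_pr) ?m_gt0 // IHv T.
have -> : \sum_(i < v.+2) chi p ^+ i = 1 + chi p * \sum_(i < v.+1) chi p ^+ i.
  by rewrite big_ord_recl mulr_sumr; congr (_ + _); apply: eq_bigr => i _; rewrite exprS.
by ring.
Qed.

Lemma sum_sign_expr x v : is_sign0 x -> let G := \sum_(i < v.+1) x ^+ i in
  [/\ 0 <= G, G != 0 -> odd v -> x != -1 & ~~ odd v -> 1 <= G].
Proof.
case/or3P=> /eqP->; cbv zeta.
- rewrite big_ord_recl big1 => [|i _]; last by rewrite expr0n.
  by split.
- under eq_bigr do rewrite expr1n.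
  by rewrite sumr_const card_ord; split; rewrite ?ler0n ?ler1n.
have -> : \sum_(i < v.+1) (-1) ^+ i = (~~ odd v)%:R :> int.
  elim: v => [|v IHv]; first by rewrite big_ord1.
  by rewrite big_ord_recr /= IHv -signr_odd /=; case: (odd v).
by case: (odd v).
Qed.

Lemma divisor_sum_sign q : (0 < q)%N -> 0 <= divisor_sum q /\
  (divisor_sum q != 0 -> forall p, prime p -> odd (logn p q) -> chi p != -1).
Proof.
move: q; apply: prime_exp_ind => [|p v m p_pr m_gt0 ndv [S_ge0 S_neq0]].
  by rewrite divisor_sum1; split => // _ p _; rewrite logn1.
have [G_ge0 G_neq0 _] := sum_sign_expr v (chi_sign0 p).
rewrite divisor_sum_prime_exp //; split; first exact: mulr_ge0.
rewrite mulf_eq0 negb_or => /andP[/G_neq0 Gv /S_neq0 Sm] r r_pr.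
rewrite lognM ?expn_gt0 ?(prime_gt0 p_pr) // lognX logn_prime //.
case: (eqVneq p r) => [<-|neq_pr]; last by rewrite muln0; apply: Sm.
by rewrite muln1 lognE p_pr m_gt0 (negPf ndv) addn0; apply: Gv.
Qed.

Lemma divisor_sum_sqr n : (0 < n)%N -> 1 <= divisor_sum (n ^ 2).
Proof.
move: n; apply: prime_exp_ind => [|p v m p_pr m_gt0 ndv S_ge1]; first by rewrite divisor_sum1.
have [_ _ G_ge1] := sum_sign_expr (v * 2) (chi_sign0 p).
rewrite expnMn -expnM divisor_sum_prime_exp ?expn_gt0 ?m_gt0 ?Euclid_dvdX ?(negPf ndv) //.
by rewrite -[1]mulr1 ler_pM // G_ge1 // oddM andbF.
Qed.
End DivisorSums.

Lemma eqn_modMl_coprime l k a b : coprime l k ->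
  (l * a == l * b %[mod k])%N = (a == b %[mod k])%N.
Proof.
move=> cop; wlog le_ab : a b / (a <= b)%N.
  by move=> h; case/orP: (leq_total a b) => le; [exact: h | rewrite eq_sym h // eq_sym].
by rewrite eq_sym [in RHS]eq_sym !eqn_mod_dvd ?leq_mul // -mulnBr Gauss_dvdr // coprime_sym.
Qed.

Lemma bernoulli_ge (x : rat) n : 0 <= x <= 1 -> 1 - n%:R * x <= (1 - x) ^+ n.
Proof.
move=> hx; elim: n => [|n IHn]; first by rewrite mul0r subr0.
rewrite exprS -natr1; have : 0 <= n%:R :> rat by [].
move: (n%:R : rat) IHn => y; nra.
Qed.

Lemma bernoulli_le (x : rat) n : 0 <= x <= 1 -> (1 - x) ^+ n * (1 + n%:R * x) <= 1.
Proof.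
move=> hx; elim: n => [|n IHn]; first by rewrite mul0r addr0 mulr1.
rewrite exprSr -natr1; apply: le_trans IHn; rewrite -mulrA ler_wpM2l ?exprn_ge0 //; first lra.
by have : 0 <= n%:R :> rat by []; move: (n%:R : rat) => y; nra.
Qed.

Lemma hyperbola_sum (V : nmodType) (F : nat -> nat -> V) M :
  \sum_(0 <= d < M) \sum_(0 <= e < M | (d.+1 * e.+1 <= M)%N) F d.+1 e.+1 =
  \sum_(0 <= q < M) \sum_(d <- divisors q.+1) F d (q.+1 %/ d)%N.
Proof.
pose G d q := F d (q %/ d)%N.
have -> : \sum_(0 <= q < M) \sum_(d <- divisors q.+1) F d (q.+1 %/ d)%N =
    \sum_(0 <= q < M) \sum_(0 <= d < M | (d.+1 %| q.+1)%N) G d.+1 q.+1.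
  rewrite big_nat_cond [RHS]big_nat_cond; apply: eq_bigr => q /andP[/andP[_ lt_qM] _].
  rewrite -[RHS]big_filter -(big_map succn xpredT (fun d => G d q.+1)); apply: perm_big.
  apply: uniq_perm; rewrite ?divisors_uniq ?map_inj_uniq ?filter_uniq ?iota_uniq //; first by move=> a b [].
  move=> d; rewrite -dvdn_divisors //; apply/idP/mapP => [dv|[e]].
    have d_gt0 : (0 < d)%N by case: d dv.
    exists d.-1; rewrite ?prednK // mem_filter prednK // dv mem_index_iota /=.
    by have := dvdn_leq (ltn0Sn q) dv; lia.
  by rewrite mem_filter => /andP[dv _] ->.
rewrite [RHS](exchange_big_dep xpredT) //=; apply: eq_bigr => d _.
pose h e := (d.+1 * e.+1).-1; have hS e : (h e).+1 = (d.+1 * e.+1)%N by [].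
rewrite -big_filter -[RHS]big_filter [RHS](perm_big [seq h e | e <- [seq e <- index_iota 0 M | d.+1 * e.+1 <= M]%N]).
  by rewrite big_map; apply: eq_bigr => e _; rewrite /G hS mulKn.
apply: uniq_perm; rewrite ?filter_uniq ?iota_uniq //.
  rewrite map_inj_uniq ?filter_uniq ?iota_uniq // => a b /(congr1 succn) /eqP.
  by rewrite !hS eqn_pmul2l // eqSS => /eqP.
move=> q; rewrite mem_filter mem_index_iota; apply/andP/mapP => [[/dvdnP[[|e] // eq_q] lt_qM]|[e]].
  exists e; last by apply/succn_inj; rewrite hS eq_q mulnC.
  by rewrite mem_filter mem_index_iota mulnC -eq_q; move: eq_q lt_qM; rewrite mulnS; lia.
by rewrite mem_filter => /andP[le_M _] ->; rewrite hS dvdn_mulr // -hS in le_M *.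
Qed.

Section SplitRepresentative.
Variables (chi : nat -> int) (k l : nat).
Hypotheses (chi_sign0 : forall q, is_sign0 (chi q)) (chi1 : chi 1 = 1)
  (chiM : forall a b, chi (a * b) = chi a * chi b)
  (chi_modn : forall a b, (a = b %[mod k])%N -> chi a = chi b)
  (chi_neq0 : forall q, coprime q k -> chi q != 0)
  (k_gt0 : (0 < k)%N) (cop_lk : coprime l k) (chi_l : chi l = 1).

(* The weight (1_{q = 1} - 1_{q = l}) of the header; it makes
   chi d * class_diff (d * e) of mean zero in d and in e. *)
Definition class_diff n : rat := (n == 1 %[mod k])%N%:R - (n == l %[mod k])%N%:R.

Let c d e : rat := (chi d)%:~R * class_diff (d * e).

Lemma class_diff_modn a b : (a = b %[mod k])%N -> class_diff a = class_diff b.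
Proof. by rewrite /class_diff => ->. Qed.

Lemma class_diff_le1 a : `|class_diff a| <= 1.
Proof. by rewrite /class_diff; do 2 case: (_ == _). Qed.

Let c_le1 d e : `|c d e| <= 1.
Proof.
rewrite /c normrM -[1]mulr1 ler_pM ?normr_ge0 ?class_diff_le1 //.
by have := chi_sign0 d; case/or3P=> /eqP->.
Qed.

Let sum_dilation (f : nat -> rat) : (forall a b, (a = b %[mod k])%N -> f a = f b) ->
  \sum_(0 <= e < k) f (l * e.+1)%N = \sum_(0 <= e < k) f e.+1.
Proof.
move=> f_modn.
have shift (g : nat -> rat) : (forall a b, (a = b %[mod k])%N -> g a = g b) ->
    \sum_(0 <= e < k) g e.+1 = \sum_(e < k) g e.
  move=> g_modn; rewrite -(big_mkord xpredT) -(big_add1 _ _ 0 k.+1 xpredT g).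
  rewrite big_nat_recr //= [in RHS]big_ltn // addrC; congr (_ + _).
  by apply: g_modn; rewrite modnn mod0n.
rewrite (shift (fun e => f (l * e)%N)) => [|a b eq_ab]; last first.
  by apply: f_modn; rewrite -modnMmr eq_ab modnMmr.
rewrite shift //; pose h (e : 'I_k) := Ordinal (ltn_pmod (l * e) k_gt0).
rewrite [RHS](reindex_inj (h := h)) /=.
  by apply: eq_bigr => e _; apply: f_modn; rewrite modn_mod.
move=> a b /(congr1 val) /= /eqP; rewrite eqn_modMl_coprime // !modn_small // => /eqP.
exact: val_inj.
Qed.

(** Multiplication by l permutes the residues and carries the class of 1 to the class of l, while g
    is invariant under it; for g = chi this is where chi(l) = 1 enters. *)
Let class_diff_sum0 (g : nat -> rat) e : (forall a b, (a = b %[mod k])%N -> g a = g b) ->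
  (forall a, g (l * a)%N = g a) -> \sum_(0 <= d < k) g d.+1 * class_diff (d.+1 * e) = 0.
Proof.
move=> g_modn gl; rewrite /class_diff; under eq_bigr do rewrite mulrBr.
rewrite sumrB; apply/eqP; rewrite subr_eq0; apply/eqP.
rewrite -(sum_dilation (f := fun d => g d * (d * e == l %[mod k])%N%:R)) => [|a b eq_ab]; last first.
  by rewrite (g_modn _ _ eq_ab) -modnMml eq_ab modnMml.
apply: eq_bigr => d _; rewrite gl; congr (_ * _%:R).
by rewrite -mulnA -{2}[l]muln1 eqn_modMl_coprime.
Qed.

Lemma split_representative :
  exists q, [/\ (0 < q)%N, (q = l %[mod k])%N & forall p, prime p -> odd (logn p q) -> chi p = 1].
Proof.
have [l1|l_neq1] := eqVneq (1 %% k)%N (l %% k)%N.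
  by exists 1%N; split => // p _; rewrite logn1.
(* This J makes the lower bound J / 2 = 2 k^5 + 3, against an upper bound 2 k^5 + 1 at the end; s
   exceeds every 1 + k j with j < J, up to equality when k = 1. *)
have [J JE0] : exists J, J = (4 * k ^ 5 + 6)%N by exists (4 * k ^ 5 + 6)%N.
have [s sE] : exists s, s = (k * J)%N by exists (k * J)%N.
pose N := (96 * s ^ 4)%N; pose M := (k * N)%N.
have [/existsP[q /and3P[q_gt0 /eqP q_l S_neq0]]|no_q] :=
    boolP [exists q : 'I_M.+1, [&& (0 < q)%N, q == l %[mod k] & divisor_sum chi q != 0]].
  exists q; split => // p p_pr p_odd; have [_ h] := divisor_sum_sign chi_sign0 chi1 chiM q_gt0.
  have := h S_neq0 p p_pr p_odd; have cop_qk : coprime q k by rewrite -coprime_modl q_l coprime_modl.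
  have : chi p != 0.
    apply: chi_neq0; apply: coprime_dvdl cop_qk; rewrite -[p]expn1 pfactor_dvdn //.
    by case: (logn p q) p_odd.
  by have := chi_sign0 p; case/or3P=> /eqP->.
exfalso.
have S0 q : (q < M)%N -> (q.+1 == l %[mod k])%N -> divisor_sum chi q.+1 = 0.
  move=> lt_qM q_l; apply/eqP; apply: contraNT no_q => S_neq0.
  by apply/existsP; exists (Ordinal (lt_qM : q.+1 < M.+1)%N); rewrite /= q_l.
have s_gt0 : (0 < s)%N by rewrite sE JE0 muln_gt0 k_gt0 addn_gt0 orbT.
(* The squares (1 + k j)^2 with j < J contribute at least J / 2 to B, since
   t ^ (s ^ 2) >= 1/2; M is so large that the truncation error is at most 1. *)
pose x : rat := (2 * s%:R ^+ 2)^-1; pose t := 1 - x.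
have s1 : 1 <= s%:R :> rat by rewrite ler1n.
have s2 : 1 <= s%:R ^+ 2 :> rat by rewrite exprn_ege1.
have x_gt0 : 0 < x by rewrite invr_gt0; lra.
have x_lt1 : x < 1 by rewrite invf_lt1; lra.
have ht : 0 < t < 1 by rewrite /t; lra.
pose F d e : rat := (chi d)%:~R * class_diff (d * e) * t ^+ (d * e).
pose A := \sum_(0 <= d < M) \sum_(0 <= e < M) F d.+1 e.+1.
pose B := \sum_(0 <= q < M) class_diff q.+1 * t ^+ q.+1 * (divisor_sum chi q.+1)%:~R.
have A_le : `|A| <= 2 * k%:R ^+ 5 + k%:R ^+ 2 * M%:R * t ^+ M.
  apply: (@double_sum_bound _ _ k_gt0 (fun d e => (chi d.+1)%:~R * class_diff (d.+1 * e.+1))) => //.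
  - move=> d e; rewrite -addSn (chi_modn (b := d.+1)) ?modnDr //.
    by rewrite (@class_diff_modn _ (d.+1 * e.+1)) // -modnMml modnDr modnMml.
  - by move=> d e; rewrite -addSn (@class_diff_modn _ (d.+1 * e.+1)) // -modnMmr modnDr modnMmr.
  - move=> d; rewrite -mulr_sumr; apply/eqP; rewrite mulf_eq0; apply/orP; right; apply/eqP.
    have := @class_diff_sum0 (fun=> 1) d.+1 (fun _ _ _ => erefl) (fun=> erefl).
    by apply: etrans; apply: eq_bigr => e _; rewrite mul1r mulnC.
  - move=> e; apply: (@class_diff_sum0 (fun d => (chi d)%:~R)) => [a b /chi_modn -> //|a].
    by rewrite chiM chi_l mul1r.
  by move=> d e; apply: c_le1.
have BE : \sum_(0 <= d < M) \sum_(0 <= e < M | (d.+1 * e.+1 <= M)%N) F d.+1 e.+1 = B.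
  rewrite hyperbola_sum; apply: eq_bigr => q _; rewrite /divisor_sum rmorph_sum /= mulr_sumr.
  apply: eq_big_seq => d; rewrite -dvdn_divisors // => dv.
  by rewrite /F mulnC divnK //; ring.
have t_ge0 n : 0 <= t ^+ n by rewrite exprn_ge0 //; lra.
(* [A] runs over the full square and [B] over d e <= M only; each of the at most M^2 omitted terms
   is at most t^M. *)
have AB : `|A - B| <= M%:R ^+ 2 * t ^+ M.
  have -> : M%:R ^+ 2 * t ^+ M = \sum_(0 <= d < M) \sum_(0 <= e < M) t ^+ M.
    by rewrite !sumr_const_nat !subn0 -mulrnA -[RHS]mulr_natl natrM expr2.
  rewrite -BE /A -sumrB; apply: le_trans (ler_norm_sum _ _ _) _; apply: ler_sum => d _.
  rewrite (bigID (fun e => d.+1 * e.+1 <= M)%N) /= addrAC subrr add0r.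
  apply: le_trans (ler_norm_sum _ _ _) _; rewrite big_mkcond /=; apply: ler_sum => e _.
  rewrite -ltnNge; case: ifP => // lt_M.
  rewrite /F normrM (ger0_norm (t_ge0 _)) -[X in _ <= X]mul1r ler_pM ?normr_ge0 //; first exact: c_le1.
  by rewrite ler_wiXn2l // ?(ltnW lt_M) //; lra.
have t_half n : (n <= s ^ 2)%N -> 2^-1 <= t ^+ n.
  move=> le_n; apply: (@le_trans _ _ (t ^+ (s ^ 2))); last by rewrite ler_wiXn2l //; lra.
  apply: le_trans (bernoulli_ge (s ^ 2) (x := x) _); last lra.
  rewrite natrX /x invfM mulrCA divff ?mulr1; last by rewrite gt_eqF //; lra.
  by lra.
pose phi j := ((k * j).+1 ^ 2).-1; have phiS j : (phi j).+1 = ((k * j).+1 ^ 2)%N by [].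
pose g q := (q.+1 == 1 %[mod k])%N%:R * t ^+ q.+1 * (divisor_sum chi q.+1)%:~R.
have g_ge0 q : 0 <= g q.
  by rewrite !mulr_ge0 // ler0z; have [] := divisor_sum_sign chi_sign0 chi1 chiM (ltn0Sn q).
have phi_le j : (j < J)%N -> ((k * j).+1 ^ 2 <= s ^ 2)%N.
  move=> lt_jJ; rewrite sE leq_exp2r // (@leq_trans (k * j.+1)) ?leq_mul2l ?lt_jJ ?orbT //.
  by rewrite mulnS addnC -addn1 leq_add2l.
have sM : (s ^ 2 <= M)%N.
  have s4 : (s ^ 4 = s ^ 2 * s ^ 2)%N by rewrite -expnD.
  have pos : (0 < k * 96 * s ^ 2)%N by rewrite !muln_gt0 k_gt0 s_gt0.
  by apply: leq_trans (leq_pmull (s ^ 2) pos) _; rewrite /M /N s4; apply: eq_leq; ring.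
have B_ge : J%:R / 2 <= B.
  have -> : B = \sum_(0 <= q < M) g q.
    rewrite /B big_nat_cond [RHS]big_nat_cond; apply: eq_bigr => q /andP[/andP[_ lt_qM] _].
    rewrite /g /class_diff -!mulrA mulrBl; case: (boolP (q.+1 == l %[mod k])%N) => [q_l|_].
      by rewrite S0 // !mulr0 subrr.
    by rewrite mul0r subr0.
  pose sq := [seq phi j | j <- index_iota 0 J].
  rewrite (bigID (fun q => q \in sq)) /= ler_wpDr ?sumr_ge0 //.
  rewrite -big_filter (perm_big sq) /=; last first.
    apply: uniq_perm; rewrite ?filter_uniq ?iota_uniq //.
      rewrite map_inj_uniq ?iota_uniq // => a b /(congr1 succn); rewrite !phiS => /eqP.
      by rewrite eqn_exp2r // eqSS eqn_pmul2l // => /eqP.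
    move=> q; rewrite mem_filter andbC mem_index_iota /=; apply: andb_idl => /mapP[j].
    rewrite mem_index_iota => /phi_le le_j ->; rewrite phiS.
    exact: leq_trans le_j sM.
  have -> : J%:R / 2 = \sum_(0 <= j < J) 2^-1 :> rat by rewrite sumr_const_nat subn0 mulr_natl.
  rewrite big_map big_seq [X in _ <= X]big_seq; apply: ler_sum => j.
  rewrite mem_index_iota => /andP[_ lt_jJ]; rewrite /g phiS -[2^-1]mulr1 ler_pM ?invr_ge0 //.
    have -> : ((k * j).+1 ^ 2 == 1 %[mod k])%N.
      by rewrite -modnXm -addn1 -modnDml modnMr add0n modnXm exp1n.
    by rewrite mul1r t_half // phi_le.
  by rewrite ler1z; apply: divisor_sum_sqr.
(* Since M = 4 * 24 k s^4, t^M is the fourth power of a y which Bernoulli's inequality bounds by 1 /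
   (12 k s^2). It then suffices that 2 * 96^2 = 18432 is less than 12^4 = 20736. *)
have tM : 2 * k%:R ^+ 2 * M%:R ^+ 2 * t ^+ M <= 1.
  have [y yE] : exists y, y = t ^+ (24 * k * s ^ 4) by exists (t ^+ (24 * k * s ^ 4)).
  have y_ge0 : 0 <= y by rewrite yE.
  have y_le : y * (12 * k%:R * s%:R ^+ 2) <= 1.
    have hx : 0 <= x <= 1 by lra.
    have := bernoulli_le (24 * k * s ^ 4) hx; rewrite -/t -yE; apply: le_trans.
    have -> : (24 * k * s ^ 4)%:R * x = 12 * k%:R * s%:R ^+ 2.
      rewrite natrM natrM natrX /x; move: (k%:R : rat) (s%:R : rat) s1 => u v v1.
      by field; rewrite gt_eqF //; lra.
    by apply: ler_wpM2l; rewrite ?lerDr.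
  have -> : t ^+ M = y ^+ 4 by rewrite yE -exprM; congr (t ^+ _); rewrite /M /N; ring.
  rewrite /M /N natrM natrM natrX.
  have : 0 <= (k%:R : rat) by [].
  move: (k%:R : rat) (s%:R : rat) s1 y_le => u v v1 y_le u_ge0.
  have y_ge0' : 0 <= y * (12 * u * v ^+ 2) by apply: (mulr_ge0 y_ge0); apply: mulr_ge0 (sqr_ge0 v); lra.
  have y4 : (y * (12 * u * v ^+ 2)) ^+ 4 <= 1 by apply: exprn_ile1.
  have h0 : 0 <= y ^+ 4 * (u ^+ 4 * v ^+ 8).
    by apply: mulr_ge0; [|apply: mulr_ge0]; apply: exprn_ge0 => //; lra.
  apply: le_trans y4; rewrite -subr_ge0.
  have -> : (y * (12 * u * v ^+ 2)) ^+ 4 - 2 * u ^+ 2 * (u * (96 * v ^+ 4)) ^+ 2 * y ^+ 4 =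
     2304 * (y ^+ 4 * (u ^+ 4 * v ^+ 8)) by ring.
  exact: mulr_ge0 (ler0n _ 2304) h0.
have k1 : 1 <= k%:R :> rat by rewrite ler1n.
have M1 : 1 <= M%:R :> rat by rewrite ler1n (leq_trans _ sM) // expn_gt0 s_gt0.
have JE : J%:R = 4 * k%:R ^+ 5 + 6 :> rat by rewrite JE0 natrD natrM natrX.
have AM : k%:R ^+ 2 * M%:R * t ^+ M <= k%:R ^+ 2 * M%:R ^+ 2 * t ^+ M.
  rewrite ler_wpM2r // ler_wpM2l ?exprn_ge0 // expr2 ler_peMr //; lra.
have BM : M%:R ^+ 2 * t ^+ M <= k%:R ^+ 2 * M%:R ^+ 2 * t ^+ M.
  by rewrite ler_wpM2r // ler_peMl ?exprn_ge0 // exprn_ege1.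
have : B <= `|A| + `|A - B| by have := ler_norm A; have := ler_norm (B - A); rewrite distrC; lra.
move: B_ge AM BM AB A_le tM; rewrite JE.
move: (k%:R ^+ 2 * M%:R * t ^+ M) (M%:R ^+ 2 * t ^+ M) (`|A|) (`|A - B|) => a1 a2 a3 a4; lra.
Qed.
End SplitRepresentative.

(** * Representations by ternary forms *)

Lemma squarefree_part q : (0 < q)%N -> exists s q' : nat,
  [/\ q = (s ^ 2 * q')%N, (0 < q')%N &
   forall p, prime p -> (p %| q')%N -> odd (logn p q) /\ ~~ (p ^ 2 %| q')%N].
Proof.
move=> q_gt0; have [|s|s dv_s max_s] := @ex_maxnP (fun s => s ^ 2 %| q)%N q; first by exists 1%N.
  by move/(dvdn_leq q_gt0); apply: leq_trans; rewrite -mulnn; nia.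
have [q' qE] := dvdnP dv_s; exists s, q'.
move: q_gt0; rewrite qE muln_gt0 => /andP[q'_gt0 s2_gt0]; have s_gt0 : (0 < s)%N by rewrite expn_gt0 orbF in s2_gt0.
split=> // [|p p_pr dv]; first by rewrite mulnC.
have p2 : ~~ (p ^ 2 %| q')%N.
  apply/negP => dv2; have := max_s (p * s)%N; rewrite expnMn qE dvdn_mul // => /(_ isT).
  by rewrite leqNgt ltn_Pmull ?prime_gt1.
split=> //; rewrite lognM // lognX mul2n oddD odd_double addbF.
rewrite pfactor_dvdn // -ltnNge in p2; rewrite -[p]expn1 pfactor_dvdn // in dv.
by move: p2 dv; case: (logn p q') => [|[|]].
Qed.

Lemma squarefree_sqrt (q : nat) (a : int) : (0 < q)%N ->
  (forall p, prime p -> (p %| q)%N -> ~~ (p ^ 2 %| q)%N /\ exists x : int, (p%:Z %| x ^+ 2 - a)%Z) ->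
  exists x : int, (q%:Z %| x ^+ 2 - a)%Z.
Proof.
move: q; apply: prime_exp_ind => [_|p v m p_pr m_gt0 ndv IHm h]; first by exists 0; rewrite dvd1z.
have [|x hx] := IHm.
  move=> r r_pr dv; have [n2 ex] := h r r_pr (dvdn_mull _ dv); split => //.
  by apply: contra n2 => dv2; apply: dvdn_mull.
case: v h => [|v] h; first by exists x; rewrite expn0 mul1n.
have := h p p_pr; rewrite expnS -mulnA dvdn_mulr // => /(_ isT)[p2 [y hy]].
have v0 : v = 0%N.
  case: v p2 {h} => // v /negP[]; rewrite (expnS p v) -mulnA mulnA mulnn; exact: dvdn_mulr.
rewrite v0 expn0 mul1n; have cop : coprimez p m by rewrite coprimezE prime_coprime.
exists (zchinese p m y x).
rewrite PoszM Gauss_dvdz //.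
have sub (w z b : int) : (w = z %[mod b])%Z -> (b %| z ^+ 2 - a)%Z -> (b %| w ^+ 2 - a)%Z.
  move=> /eqP; rewrite eqz_mod_dvd => d1 d2.
  have -> : w ^+ 2 - a = (w - z) * (w + z) + (z ^+ 2 - a) by ring.
  by rewrite rpredD ?dvdz_mulr.
by apply/andP; split; [apply: sub hy; apply: zchinese_modl | apply: sub hx; apply: zchinese_modr].
Qed.

Lemma chi_sqrt D p : prime p -> odd p -> ~~ (p %| D)%N -> (0 < D)%N -> chi D p = 1 ->
  exists x : int, (p%:Z %| x ^+ 2 + D%:Z)%Z.
Proof.
move=> p_pr p_odd ndv D_gt0; rewrite chi_prime // => /legendre_sqrt[] // x xE.
exists (x : nat)%:Z.
have -> : (x : nat)%:Z ^+ 2 + D%:Z = ((x : nat) ^ 2 + D)%N by rewrite PoszD -mulnn PoszM expr2.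
rewrite dvdzE /=.
rewrite (dvdn_pcharf (pchar_Fp p_pr)) natrD natrX natr_Zp -xE.
by rewrite addNr.
Qed.

(** From D d = 1 mod q one gets -d = -D d^2 mod q', so a root x of -D modulo each prime of q' gives
    the root d x of -d; the Chinese remainder theorem combines these into B. *)
Lemma exists_binary_form D l : (0 < D)%N -> coprime l (8 * D) -> chi D l = 1 ->
  exists q s q' : nat, [/\ (0 < q)%N, (q = l %[mod 8 * D])%N, q = (s ^ 2 * q')%N, (0 < q')%N &
   forall d j : nat, (D * d = j * q + 1)%N -> exists A B : int, A * q'%:Z - B ^+ 2 = d%:Z].
Proof.
move=> D_gt0 cop chi_l.
have [|q [q_gt0 q_l hq]] := split_representative (@chi_sign0 D) (chi1 D) (@chiM D) (@chi_modn D)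
  (@chi_neq0 D) _ cop chi_l; first by rewrite muln_gt0.
have [s [q' [qE q'_gt0 hq']]] := squarefree_part q_gt0.
exists q, s, q'; split=> // d j dE.
have cop_q : coprime q (8 * D) by rewrite -coprime_modl q_l coprime_modl.
have [|x] := @squarefree_sqrt q' (- d%:Z) q'_gt0; last first.
  by case/dvdzP=> A AE; exists A, x; rewrite -AE; ring.
move=> p p_pr dv; have [p_odd p2] := hq' p p_pr dv; split => //.
have dvq : (p %| q)%N by rewrite qE dvdn_mull.
have : coprime p (8 * D) := coprime_dvdl dvq cop_q.
rewrite coprimeMr -[8%N]/(2 ^ 3)%N coprime_pexpr // coprimen2 prime_coprime // => /andP[odd_p ndv].
have [x hx] := chi_sqrt p_pr odd_p ndv D_gt0 (hq p p_pr p_odd).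
exists (d%:Z * x); rewrite opprK.
have -> : (d%:Z * x) ^+ 2 + d%:Z = d%:Z ^+ 2 * (x ^+ 2 + D%:Z) - d%:Z * j%:Z * q%:Z.
  have jq : j%:Z * q%:Z = D%:Z * d%:Z - 1 by rewrite -!PoszM dE PoszD addrK.
  by rewrite -[_ * q%:Z]mulrA jq; ring.
by rewrite rpredB ?dvdz_mull.
Qed.

Lemma odd_two_times_sum3 m : odd m -> exists u v w : int, (2 * m)%:Z = u ^+ 2 + v ^+ 2 + w ^+ 2.
Proof.
move=> m_odd; have m_gt0 : (0 < m)%N by case: m m_odd.
have l_odd : odd (2 * m - 1) by lia.
have [||q [s [q' [q_gt0 q_l qE q'_gt0 form]]]] := @exists_binary_form (2 * m) (2 * m - 1) _ _ (chi_double_pred m_odd).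
- by rewrite muln_gt0.
- rewrite (_ : 8 * (2 * m) = 2 ^ 4 * m)%N; last by ring.
  rewrite coprimeMr coprime_pexpr // coprimen2 l_odd /=.
  have := coprimenS (2 * m - 1); have -> : (2 * m - 1).+1 = (2 * m)%N by lia.
  by rewrite coprimeMr => /andP[].
have dv : (2 * m %| q + 1)%N.
  have dvk := dvdn_mull 8 (dvdnn (2 * m)); have := q_l.
  move/(congr1 (modn^~ (2 * m)%N)); rewrite !modn_dvdm // => q_l'.
  by rewrite /dvdn -modnDml q_l' modnDml subnK ?muln_gt0 // modnn.
case/dvdnP: dv => d dE.
have [|A [B AB]] := form d 1%N; first by rewrite mul1n dE mulnC.
have d_gt0 : (0 < d)%N by case: d dE AB {form} => //; lia.
have A_gt0 : 0 < A.
  have : 0 < A * q'%:Z by rewrite -(subrK (B ^+ 2) (A * _)) AB ltr_wpDr ?sqr_ge0 ?ltz_nat.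
  by rewrite pmulr_lgt0 // ltz_nat.
(* The matrix with diagonal A, q', 2m and off-diagonal entries B, s, 0 has determinant 2m d - s^2 q'
   = 2m d - q = 1 and takes the value 2m at (0, 0, 1). *)
have [|| u [v [w uvw]]] := @ternary_det1_represents A q' (2 * m)%:Z 0 s B A_gt0 _ _ 0 0 1.
- by rewrite AB ltz_nat.
- have : (2 * m)%:Z * d%:Z = s%:Z ^+ 2 * q'%:Z + 1.
    by rewrite -PoszM mulnC -dE qE PoszD PoszM -mulnn PoszM expr2.
  rewrite /tdet -AB; move: (2 * m)%:Z => D De.
  by rewrite -[1](addKr (s%:Z ^+ 2 * q'%:Z)) -De; ring.
by exists u, v, w; rewrite -uvw /tform; ring.
Qed.

Lemma exists_mod3 (x : int) : exists y : int, x = 3 * y \/ x = 3 * y + 1 \/ x = 3 * y - 1.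
Proof.
have := divz_eq x 3; have := modz_ge0 x (isT : 3 != 0 :> int).
have := ltz_pmod x (isT : 0 < 3 :> int); move: (x %/ 3)%Z (x %% 3)%Z => q r r3 r0 ->.
have [->|[->|->]] : r = 0 \/ r = 1 \/ r = 2 by lia.
- by exists q; lia.
- by exists q; lia.
by exists (q + 1); lia.
Qed.

Lemma square_mod3 (x k : int) : x ^+ 2 <> 3 * k + 2.
Proof. by have [y [->|[->|->]]] := exists_mod3 x; lia. Qed.

Lemma mod3_sum_133 m : (m %% 3 = 1)%N -> exists u v w : int, m%:Z = u ^+ 2 + 3 * v ^+ 2 + 3 * w ^+ 2.
Proof.
move=> m3; have m_gt0 : (0 < m)%N by case: m m3.
have [l lE] : exists l, (3 * l + 1 = 16 * m)%N by exists ((16 * m - 1) %/ 3)%N; lia.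
have l_odd : odd l by lia.
have [|q [s [q' [q_gt0 q_l qE q'_gt0 form]]]] := @exists_binary_form m l m_gt0 _ (chi_sixteen_thirds m3 lE).
  rewrite coprimeMr -[8%N]/(2 ^ 3)%N coprime_pexpr // coprimen2 l_odd /=.
  have := coprimenS (3 * l); have -> : (3 * l).+1 = (16 * m)%N by lia.
  by rewrite coprimeMr => /andP[_]; rewrite coprimeMl => /andP[].
have dv : (m %| 3 * q + 1)%N.
  have dvk := dvdn_mull 8 (dvdnn m); have := q_l.
  move/(congr1 (modn^~ m)); rewrite !modn_dvdm // => q_l'.
  by rewrite /dvdn -modnDml -modnMmr q_l' modnMmr modnDml lE modnMl.
case/dvdnP: dv => d dE.
have [|A [B AB]] := form d 3; first by rewrite dE mulnC.
have d3 : (d %% 3 = 1)%N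
  by have : (d * (m %% 3) = 1 %[mod 3])%N; [rewrite modnMmr -dE mulnC modnMDl | rewrite m3 muln1].
have d_gt0 : (0 < d)%N by case: d d3 {dE AB}.
have A_gt0 : 0 < A.
  have : 0 < A * q'%:Z by rewrite -(subrK (B ^+ 2) (A * _)) AB ltr_wpDr ?sqr_ge0 ?ltz_nat.
  by rewrite pmulr_lgt0 // ltz_nat.
have mdE : m%:Z * d%:Z = 3 * (s%:Z ^+ 2 * q'%:Z) + 1.
  by rewrite -PoszM mulnC -dE qE PoszD !PoszM expr2.
have det : tdet A q' (3 * m%:Z) 0 (3 * s%:Z) B = 3.
  rewrite /tdet -AB in mdE *.
  transitivity (3 * (m%:Z * (A * q'%:Z - B ^+ 2)) - 9 * (s%:Z ^+ 2 * q'%:Z)); first by ring.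
  by rewrite mdE; ring.
(* The same matrix with 3m and 3s has determinant 3 m d - 9 q = 3, because m d = 3 q + 1. *)
have [||| u [v [w uvw]]] := @ternary_det3_represents A q' (3 * m%:Z) 0 (3 * s%:Z) B A_gt0 _ _ _ 0 0 1.
- by rewrite AB ltz_nat.
- exact: det.
- move=> x y z k e; set F := tform _ _ _ _ _ _ _ _ _ in e.
  have := adjoint_form_identity A q' (3 * m%:Z) 0 (3 * s%:Z) B x y z.
  rewrite det -/F e AB; set X := (_ + _ + _ : int); set Y := (_ - _ + _ : int) => XY.
  have [d' d'E] : exists d' : int, d%:Z = 3 * d' + 1.
    by exists (d %/ 3)%N; rewrite {1}(divn_eq d 3) d3 PoszD PoszM mulrC.
  apply: (@square_mod3 X (d%:Z * k + 2 * d' - Y)).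
  by clearbody X Y; clear -XY d'E; lia.
(* A sum of two squares divisible by 3 has both terms divisible by 3; dividing 3m = u^2 + v^2 + 3
   w^2 by 3 then gives the form sought. *)
have uv3 : u ^+ 2 + v ^+ 2 = 3 * (m%:Z - w ^+ 2) by clear -uvw; rewrite /tform in uvw; lia.
have [u' uE] := exists_mod3 u; have [v' vE] := exists_mod3 v; exists w, u', v'; clear -uv3 uE vE.
by case: uE => [|[|]] uE; case: vE => [|[|]] vE; rewrite uE vE in uv3; lia.
Qed.

Lemma exists_mod2 (x : int) : exists y : int, x = 2 * y \/ x = 2 * y + 1.
Proof.
have := divz_eq x 2; have := modz_ge0 x (isT : 2 != 0 :> int).
have := ltz_pmod x (isT : 0 < 2 :> int); move: (x %/ 2)%Z (x %% 2)%Z => q r r2 r0 ->.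
have [->|->] : r = 0 \/ r = 1 by lia.
  by exists q; lia.
by exists q; lia.
Qed.

(** In 2m = a^2 + b^2 + c^2, which is 2 modulo 4, exactly two terms are odd, say a and b. Then m =
    ((a + b) / 2)^2 + ((a - b) / 2)^2 + 2 (c / 2)^2, and as m is odd one of the first two squares is
    even. *)
Lemma odd_sum_124 m : odd m -> exists u v w : int, m%:Z = u ^+ 2 + 2 * v ^+ 2 + 4 * w ^+ 2.
Proof.
move=> m_odd; have [a [b [c abc]]] := odd_two_times_sum3 m_odd.
have [m' mE] : exists m' : int, m%:Z = 2 * m' + 1.
  by exists (m./2)%:Z; rewrite -{1}(odd_double_half m) m_odd; lia.
have half (x y z : int) : m%:Z = x ^+ 2 + y ^+ 2 + 2 * z ^+ 2 ->
    exists u v w : int, m%:Z = u ^+ 2 + 2 * v ^+ 2 + 4 * w ^+ 2.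
  clear -mE => e; have [x' [xE|xE]] := exists_mod2 x; first by exists y, z, x'; rewrite e xE; ring.
  have [y' [yE|yE]] := exists_mod2 y; first by exists x, z, y'; rewrite e yE; ring.
  by rewrite mE xE yE in e; lia.
have {}abc : 2 * m%:Z = a ^+ 2 + b ^+ 2 + c ^+ 2 by rewrite -abc PoszM.
have pair (x y z : int) : 2 * m%:Z = (2 * x + 1) ^+ 2 + (2 * y + 1) ^+ 2 + (2 * z) ^+ 2 ->
    exists u v w : int, m%:Z = u ^+ 2 + 2 * v ^+ 2 + 4 * w ^+ 2.
  by move=> e; apply: (half (x + y + 1) (x - y) z); clear -e; lia.
have [a' [aE|aE]] := exists_mod2 a; have [b' [bE|bE]] := exists_mod2 b;
have [c' [cE|cE]] := exists_mod2 c; rewrite aE bE cE in abc; try (by move: abc; rewrite mE; clear; lia).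
- by apply: (pair b' c' a'); clear -abc; lia.
- by apply: (pair a' c' b'); clear -abc; lia.
by apply: (pair a' b' c'); clear -abc; lia.
Qed.

(** * From ternary to quaternary representations *)

Lemma nonneg_int_nat (a : int) : 0 <= a -> exists n : nat, a = n.
Proof. by case: a => // n _; exists n. Qed.

Lemma int_sqr_nat (a : int) : exists n : nat, a ^+ 2 = n%:Z ^+ 2.
Proof. by exists `|a|%N; rewrite abszE real_normK ?num_real. Qed.

Lemma form_int_nat (n x y z w : nat) :
  n%:Z = x%:Z ^+ 2 + y%:Z ^+ 2 + z%:Z ^+ 2 + 2 * w%:Z ^+ 2 ->
  (n = x ^ 2 + y ^ 2 + z ^ 2 + 2 * w ^ 2)%N.
Proof. by rewrite -!mulnn; lia. Qed.

Lemma sqr_le_bounds (u p : int) : 0 <= p -> u ^+ 2 <= p ^+ 2 -> - p <= u <= p.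
Proof.
by move=> p_ge0 le; rewrite -ler_norml -(ler_pXn2r (ltn0Sn 1)) ?nnegrE // real_normK ?num_real.
Qed.

Lemma prime_window_xy n p : prime p -> odd p -> (n <= p ^ 2 <= 2 * n)%N ->
  exists x y z w : nat, (n = x ^ 2 + y ^ 2 + z ^ 2 + 2 * w ^ 2)%N /\ (x + y = p)%N.
Proof.
move=> p_pr p_odd /andP[le_np le_pn].
have m_odd : odd (2 * n - p ^ 2) by rewrite oddB // oddM oddX p_odd orbT.
have [u [v [w e]]] := odd_sum_124 m_odd.
have {}e : 2 * n%:Z - p%:Z ^+ 2 = u ^+ 2 + 2 * v ^+ 2 + 4 * w ^+ 2.
  by rewrite -e -subzn // PoszM -mulnn PoszM expr2.
have {}le_np : n%:Z <= p%:Z ^+ 2 by move: le_np; rewrite -mulnn -lez_nat PoszM expr2.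
have /andP[up1 up2] : - p%:Z <= u <= p%:Z.
  by apply: sqr_le_bounds => //; have := sqr_ge0 v; have := sqr_ge0 w; lia.
have [p' pE] : exists p' : int, p%:Z = 2 * p' + 1.
  by exists (p./2)%:Z; rewrite -{1}(odd_double_half p) p_odd; lia.
have [u' [uE|uE]] := exists_mod2 u; first by rewrite uE pE in e; clear -e; lia.
(* These are x = (p + u) / 2 and y = (p - u) / 2, nonnegative because u^2 <= 2n - p^2 <= p^2. *)
have [|x xE] := @nonneg_int_nat (p' + u' + 1); first by lia.
have [|y yE] := @nonneg_int_nat (p' - u'); first by lia.
have [z zE] := int_sqr_nat v; have [t tE] := int_sqr_nat w.
exists x, y, z, t; split.
  apply: form_int_nat; rewrite -zE -tE -xE -yE; rewrite uE pE in e; clear -e; lia.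
by clear -xE yE pE; lia.
Qed.

Lemma prime_window_xw n p : prime p -> (3 < p)%N -> (n <= p ^ 2)%N -> (2 * p ^ 2 <= 3 * n)%N ->
  exists x y z w : nat, (n = x ^ 2 + y ^ 2 + z ^ 2 + 2 * w ^ 2)%N /\ (x + w = p)%N.
Proof.
move=> p_pr p_gt3 le_np le_pn.
have ndv : ~~ (3 %| p)%N by rewrite dvdn_prime2 //; lia.
have [p' pE] : exists p' : int, p%:Z = 3 * p' + 1 \/ p%:Z = 3 * p' - 1.
  by have [p' [pE|pE]] := exists_mod3 p%:Z; exists p' => //; exfalso; lia.
have m3 : ((3 * n - 2 * p ^ 2) %% 3 = 1)%N.
  have : (p ^ 2 %% 3 = 1)%N.
    by rewrite -modnXm; have [->|->] : (p %% 3 = 1 \/ p %% 3 = 2)%N by clear -ndv; lia.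
  by move: (p ^ 2)%N le_pn => s; clear; lia.
have [u [v [w e]]] := mod3_sum_133 m3.
have {}e : 3 * n%:Z - 2 * p%:Z ^+ 2 = u ^+ 2 + 3 * v ^+ 2 + 3 * w ^+ 2.
  by rewrite -e -subzn // !PoszM -mulnn PoszM expr2.
have {}le_np : n%:Z <= p%:Z ^+ 2 by move: le_np; rewrite -mulnn -lez_nat PoszM expr2.
have le_up : u ^+ 2 <= p%:Z ^+ 2 by have := sqr_ge0 v; have := sqr_ge0 w; lia.
(* Since u^2 = p^2 modulo 3, the sign of u can be chosen with u = p mod 3. Then u' = (p - u) / 3
   serves as w and p - u' as x; |u| <= p makes both nonnegative. *)
wlog [u' uE] : u e le_up / exists u', u = p%:Z - 3 * u'.
  move=> h; have [u' uE] := exists_mod3 u.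
  have [uE'|uE'] : (exists u', u = p%:Z - 3 * u') \/ exists u', - u = p%:Z - 3 * u'.
    case: pE uE => pE; case=> [uE|[uE|uE]].
    - by rewrite uE pE in e; clear -e; lia.
    - by left; exists (p' - u'); rewrite pE uE; ring.
    - by right; exists (p' + u'); rewrite pE uE; ring.
    - by rewrite uE pE in e; clear -e; lia.
    - by right; exists (p' + u'); rewrite pE uE; ring.
    by left; exists (p' - u'); rewrite pE uE; ring.
  - exact: h e le_up uE'.
  by apply: (h (- u)); rewrite ?sqrrN.
have /andP[up1 up2] := sqr_le_bounds (isT : 0 <= p%:Z) le_up.
have [|x xE] := @nonneg_int_nat (p%:Z - u'); first by lia.
have [|y yE] := @nonneg_int_nat u'; first by lia.
have [z zE] := int_sqr_nat v; have [t tE] := int_sqr_nat w.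
exists x, z, t, y; split.
  apply: form_int_nat; rewrite -zE -tE -xE -yE; rewrite uE in e; clear -e; lia.
by clear -xE yE; lia.
Qed.

Local Close Scope ring_scope.

Theorem corollary3 :
  (forall n : nat, 1 < n ->
     exists x y z w p : nat,
       [/\ prime p, n = x ^ 2 + y ^ 2 + z ^ 2 + 2 * w ^ 2 & x + y = p]) /\
  (forall n : nat, 2 < n ->
     exists x y z w : nat,
       n = x ^ 2 + y ^ 2 + z ^ 2 + 2 * w ^ 2 /\ prime (x + w)).
Proof.
split=> n n_gt.
  have [le_n|lt_n] := leqP 561 n; last exact: small_prime_xy.
  have [p [p_pr le_np le_pn]] := exists_prime_window le_n.
  have p_odd : odd p by case: (even_prime p_pr) le_np => // -> le_n4; have := leq_trans le_n le_n4.
  have [|x [y [z [w [nE xy]]]]] := prime_window_xy p_pr p_odd (n := n); first by rewrite le_np; lia.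
  by exists x, y, z, w, p.
have [le_n|lt_n] := leqP 561 n; last exact: small_prime_xw.
have [p [p_pr le_np le_pn]] := exists_prime_window le_n.
have p_gt3 : 3 < p.
  rewrite ltnNge; apply/negP => le_p3; have : p ^ 2 <= 3 ^ 2 by rewrite leq_exp2r.
  by move/(leq_trans le_np)/(leq_trans le_n).
have [x [y [z [w [nE xw]]]]] := prime_window_xw p_pr p_gt3 le_np le_pn.
by exists x, y, z, w; rewrite xw.
Qed.
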